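(* Let $\Omega\subset\mathbb{R}^N$ ($N\ge2$) be an open, bounded and connected domain of class $C^2$, let $\alpha\in(0,1)$, let $\tau_0(\alpha)\in(-1,0)$ be as in the context, and let $f\in C^\beta_{loc}(\Omega)$ for some $\beta>0$ with $f\ge0$ in $\Omega$. For $p>1$ consider the problem $$(P)\qquad (-\Delta)^\alpha u+|u|^{p-1}u=f\ \text{ in }\Omega,\qquad u=0\ \text{ in }\overline\Omega^{\,c},\qquad \lim_{x\in\Omega,\,x\to\partial\Omega}u(x)=+\infty ,$$ and for $\gamma\in(-1-2\alpha,0)$ the condition $$(H_\gamma)\qquad 0<\liminf_{x\in\Omega,\,x\to\partial\Omega}f(x)d(x)^{-\gamma}\le\limsup_{x\in\Omega,\,x\to\partial\Omega}f(x)d(x)^{-\gamma}<+\infty .$$ (i) (weak source) If $p\ge1-\frac{2\alpha}{\tau_0(\alpha)}$ and $f$ satisfies $(H_\gamma)$ with $-2\alpha-\frac{2\alpha}{p-1}\le\gamma<-2\alpha$, then the solution of $(P)$ satisfying $$0<\liminf_{x\in\Omega,\,x\to\partial\Omega}u(x)d(x)^{-\gamma-2\alpha}\le\limsup_{x\in\Omega,\,x\to\partial\Omega}u(x)d(x)^{-\gamma-2\alpha}<+\infty$$ is positive in $\Omega$ and unique. (ii) (strong source) If $p>1+2\alpha$ and $f$ satisfies $(H_\gamma)$ with $-1-2\alpha<\gamma<-2\alpha-\frac{2\alpha}{p-1}$, then the solution of $(P)$ satisfying $$0<\liminf_{x\in\Omega,\,x\to\partial\Omega}u(x)d(x)^{-\frac{\gamma}{p}}\le\limsup_{x\in\Omega,\,x\to\partial\Omega}u(x)d(x)^{-\frac{\gamma}{p}}<+\infty$$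 is positive in $\Omega$ and unique.
   Context: Notation: $d(x)=\mathrm{dist}(x,\partial\Omega)$; limits, liminf and limsup as $x\in\Omega$, $x\to\partial\Omega$ are taken as $d(x)\to0$ with $x\in\Omega$. Fractional Laplacian: $(-\Delta)^\alpha u(x)=-\frac12\int_{\mathbb{R}^N}\frac{\delta(u,x,y)}{|y|^{N+2\alpha}}\,dy$, where $\delta(u,x,y)=u(x+y)+u(x-y)-2u(x)$. $L^1_\omega(\mathbb{R}^N)$ is the weighted $L^1$ space with weight $\omega(y)=\frac{1}{1+|y|^{N+2\alpha}}$. Solution of $(P)$: a classical solution, i.e. a function $u:\mathbb{R}^N\setminus\partial\Omega\to\mathbb{R}$, continuous in $\Omega$ and in $L^1_\omega(\mathbb{R}^N)$, such that $(-\Delta)^\alpha u(x)$ is well defined and satisfies the equation for every $x\in\Omega$, $u=0$ a.e. in $\overline\Omega^{\,c}$, and $u(x)\to+\infty$ as $x\in\Omega$, $x\to\partial\Omega$. The number $\tau_0(\alpha)$: for $\tau\in(-1,0)$ let $$C(\tau)=\int_0^{+\infty}\frac{\chi_{(0,1)}(t)|1-t|^\tau+(1+t)^\tau-2}{t^{1+2\alpha}}\,dt,$$ where $\chi_{(0,1)}$ is the characteristic function of $(0,1)$. Then $\tau_0(\alpha)$ is the unique $\tau\in(-1,0)$ with $C(\tau)=0$. *)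

(* Defs.v *)
From HB Require Import structures.
From mathcomp Require Import all_boot all_order all_algebra.
From mathcomp Require Import all_classical all_reals all_analysis.

Set Implicit Arguments.
Unset Strict Implicit.
Unset Printing Implicit Defensive.

Import Order.TTheory GRing.Theory Num.Theory.
Import numFieldNormedType.Exports.

Local Open Scope classical_set_scope.
Local Open Scope ring_scope.

(* The library norm on 'rV[R]_n is the sup norm; it induces the right topology
   but |x| in the statement is Euclidean. *)
Definition enorm (R : realType) (n : nat) (x : 'rV[R]_n) : R :=
  Num.sqrt (\sum_(i < n) x 0 i ^+ 2).

Section lebesgue_Rn.
Variables (R : realType) (n : nat).
Local Open Scope ereal_scope.

Definition box (ab : 'rV[R]_n.+1 * 'rV[R]_n.+1) : set 'rV[R]_n.+1 :=
  [set x | forall i, (ab.1 ord0 i <= x ord0 i < ab.2 ord0 i)%R].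

Definition box_volume (ab : 'rV[R]_n.+1 * 'rV[R]_n.+1) : R :=
  (\prod_(i < n.+1) Num.max 0 (ab.2 ord0 i - ab.1 ord0 i))%R.

Definition box_cover (A : set 'rV[R]_n.+1) :=
  [set B : nat -> 'rV[R]_n.+1 * 'rV[R]_n.+1 | A `<=` \bigcup_k box (B k)].

Definition lebesgue_outer (A : set 'rV[R]_n.+1) : \bar R :=
  ereal_inf [set \sum_(k <oo) (box_volume (B k))%:E | B in box_cover A].

Let vol_ge0 B : 0 <= (box_volume B)%:E.
Proof. by rewrite lee_fin prodr_ge0// => i _; rewrite le_max lexx. Qed.

Let lebesgue_outer_ge0 A : 0 <= lebesgue_outer A.
Proof.
by apply: le_ereal_inf_tmp => x [B _ <-]; apply: nneseries_ge0 => k _ _.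
Qed.

Let le_lebesgue_outer : {homo lebesgue_outer : A B / A `<=` B >-> A <= B}.
Proof.
move=> A B AB; apply: ereal_inf_le_tmp => x [F FB <-].
by exists F => //; exact: subset_trans FB.
Qed.

Let lebesgue_outer0 : lebesgue_outer set0 = 0.
Proof.
apply/eqP; rewrite eq_le lebesgue_outer_ge0 andbT.
apply: ereal_inf_lbound; exists (fun=> (0%R, 0%R)) => //.
rewrite eseries0// => k _ _; congr EFin.
by rewrite /box_volume big_ord_recl/= subrr maxxx mul0r.
Qed.

Let lebesgue_outer_sigma_subadditive : sigma_subadditive lebesgue_outer.
Proof.
move=> A; have [[i ioo]|] := pselect (exists i, lebesgue_outer (A i) = +oo).
  rewrite (eseries_pinfty _ _ ioo) ?leey// => k _.
  by rewrite gt_eqF// (lt_le_trans _ (lebesgue_outer_ge0 _)).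
rewrite -forallNE => Aoo.
suff add2e (e : {posnum R}) :
    lebesgue_outer (\bigcup_n A n) <=
    \sum_(i <oo) lebesgue_outer (A i) + e%:num%:E.
  by apply/lee_addgt0Pr => _/posnumP[].
rewrite (le_trans _ (epsilon_trick _ _ _))//.
pose P k B := box_cover (A k) B /\
  \sum_(j <oo) (box_volume (B j))%:E <=
  lebesgue_outer (A k) + (e%:num / (2 ^ k.+1)%:R)%:E.
have [G PG] : {G & forall k, P k (G k)}.
  apply: (@choice _ _ P) => k; rewrite /P.
  have en1 : (0 < e%:num / (2 ^ k.+1)%:R :> R)%R by [].
  have fA : lebesgue_outer (A k) \is a fin_num.
    rewrite ge0_fin_numE// ltNge leye_eq; apply/eqP; exact: Aoo.
  have [_ [B AB <-] Blt] := lb_ereal_inf_adherent en1 fA.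
  by exists B; split => //; exact: ltW.
pose vol ij := (box_volume (uncurry G ij))%:E.
have vol0 ij : 0 <= vol ij by exact: vol_ge0.
apply: (@le_trans _ _ (\esum_(ij in setT) vol ij)).
  apply: ereal_inf_lbound => /=.
  have /card_esym/ppcard_eqP[f] := card_nat2.
  exists (uncurry G \o f).
    move=> t [i _] /(PG i).1 [j _ ijt]; exists (f^-1%FUN (i, j)) => //=.
    by rewrite invK ?inE.
  rewrite -(esum_pred_image vol _ xpredT) ?[fun=> _]set_true//.
  by rewrite image_eq.
rewrite (_ : esum _ _ = \sum_(i <oo) \sum_(j <oo) vol (i, j)); last first.
  pose J : nat -> set (nat * nat) := fun i => [set (i, j) | j in setT].
  rewrite (_ : setT = \bigcup_k J k); last first.
    by rewrite predeqE => -[a b]; split => // _; exists a => //; exists b.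
  rewrite esum_bigcupT//=; last first.
    apply/trivIsetP => i j _ _ ij.
    rewrite predeqE => -[k m] /=; split => //= -[] [_] _ [<-{k} _].
    by move=> [m' _] [] /esym/eqP; rewrite (negbTE ij).
  rewrite -(image_id [set: nat]) -fun_true esum_pred_image//; last first.
    by move=> k _; exact: esum_ge0.
  apply: eq_eseriesr => /= j _.
  rewrite -(esum_pred_image vol (pair j) predT)//=; last first.
    by move=> ? ? _ _; exact: (@can_inj _ _ _ snd).
  by congr esum; rewrite predeqE => -[a b]; split; move=> [i _ <-]; exists i.
by apply: lee_nneseries => i _; [move=> _; exact: nneseries_ge0|exact: (PG i).2].
Qed.

HB.instance Definition _ := isOuterMeasure.Build R 'rV[R]_n.+1 lebesgue_outer
  lebesgue_outer0 lebesgue_outer_ge0 le_lebesgue_outer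
  lebesgue_outer_sigma_subadditive.

(* Lebesgue measure on its complete sigma-algebra: the values of a function on
   a null set affect neither its measurability nor its integral. *)
Definition lebesgue_Rn : set (caratheodory_type lebesgue_outer) -> \bar R :=
  lebesgue_outer.

HB.instance Definition _ := isMeasure.Build _ _ _ lebesgue_Rn
  (@caratheodory_measure0 _ _ lebesgue_outer)
  (@caratheodory_measure_ge0 _ _ lebesgue_outer)
  (@caratheodory_measure_sigma_additive _ _ lebesgue_outer).

End lebesgue_Rn.

Arguments lebesgue_Rn : clear implicits.

Section domains.
Variables (R : realType) (n : nat).
Implicit Types (A : set 'rV[R]_n) (g : 'rV[R]_n -> R).

Definition bdry A : set 'rV[R]_n := closure A `\` A°.

Definition dist_bdry A (x : 'rV[R]_n) : R :=
  inf [set enorm (x - y) | y in bdry A].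

(* the filter of "x in A and d(x) -> 0" *)
Definition near_bdry A : set_system 'rV[R]_n :=
  filter_from [set e : R | 0 < e]
    (fun e => [set x | A x /\ dist_bdry A x < e]).

(* 0 < liminf g d^s <= limsup g d^s < +oo at the boundary of A *)
Definition exact_rate A g (s : R) : Prop :=
  let h x := (g x * dist_bdry A x `^ s)%:E in
  [/\ (0 < limf_einf h (near_bdry A))%E,
      (limf_einf h (near_bdry A) <= limf_esup h (near_bdry A))%E
    & (limf_esup h (near_bdry A) < +oo)%E].

Definition locally_hoelder A (b : R) g : Prop :=
  forall K : set 'rV[R]_n, compact K -> K `<=` A ->
  exists C : R, forall x y, K x -> K y ->
    `|g x - g y| <= C * enorm (x - y) `^ b.

(* [Ckb k b A g]: partial derivatives up to order k exist and are continuous in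
   A, those of order k being locally b-Hoelder there (b = 0 adds nothing). *)
Fixpoint Ckb (k : nat) (b : R) A g : Prop :=
  {within A, continuous g} /\
  match k with
  | 0 => locally_hoelder A b g
  | k'.+1 => forall i : 'I_n,
      (forall x, A x -> derivable g x (delta_mx 0 i)) /\
      Ckb k' b A (fun x => 'D_(delta_mx 0 i) g x)
  end.

(* C^beta = C^{k,beta-k} with k the integer part of beta *)
Definition C_loc (beta : R) A g : Prop :=
  Ckb (Num.truncn beta) (beta - (Num.truncn beta)%:R) A g.

End domains.

(* Near each boundary point, up to relabelling and reversing coordinate axes,
   Omega is the epigraph of a C^2 function of the other coordinates. *)
Definition C2_domain (R : realType) (n : nat) (Omega : set 'rV[R]_n.+1) :=
  forall x0, bdry Omega x0 ->
  exists (i : 'I_n.+1) (s : bool) (r : R) (phi : 'rV[R]_n -> R),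
    [/\ 0 < r, Ckb 2 0 setT phi
      & forall x, enorm (x - x0) < r ->
          (Omega x <-> 0 < (-1) ^+ s * (x 0 i - phi (col' i x)))].

Section fractional_laplacian.
Variables (R : realType) (n : nat).
Implicit Types (u f : 'rV[R]_n.+1 -> R) (Omega : set 'rV[R]_n.+1).

Definition second_diff u (x y : 'rV[R]_n.+1) : R :=
  u (x + y) + u (x - y) - 2 * u x.

Definition frac_kernel (alpha : R) u (x y : 'rV[R]_n.+1) : R :=
  second_diff u x y / enorm y `^ (n.+1%:R + 2 * alpha).

Definition frac_lap_defined (alpha : R) u x : Prop :=
  (lebesgue_Rn R n).-integrable setT (EFin \o frac_kernel alpha u x).

Definition frac_lap (alpha : R) u x : R :=
  - 2^-1 * \int[lebesgue_Rn R n]_(y in setT) frac_kernel alpha u x y.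

Definition in_L1_omega (alpha : R) u : Prop :=
  (lebesgue_Rn R n).-integrable setT
    (fun y => (u y / (1 + enorm y `^ (n.+1%:R + 2 * alpha)))%:E).

(* u is total, but its values on the (null) boundary of Omega play no role *)
Definition solution (alpha p : R) Omega f u : Prop :=
  [/\ {within Omega, continuous u},
      in_L1_omega alpha u,
      forall x, Omega x -> frac_lap_defined alpha u x /\
        frac_lap alpha u x + `|u x| `^ (p - 1) * u x = f x,
      {ae lebesgue_Rn R n, forall x, ~ closure Omega x -> u x = 0}
    & u @ near_bdry Omega --> +oo].

(* Uniqueness is that of functions defined on the complement of the boundary,
   up to null sets outside Omega. *)
Definition positive_unique_solution (alpha p : R) Omega f (s : R) : Prop :=
  let S := [set u | solution alpha p Omega f u /\ exact_rate Omega u s] in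
  (forall u, S u -> forall x, Omega x -> 0 < u x) /\
  (forall u v, S u -> S v ->
     (forall x, Omega x -> u x = v x) /\
     {ae lebesgue_Rn R n, forall x, ~ bdry Omega x -> u x = v x}).

End fractional_laplacian.

Definition C_tau (R : realType) (alpha tau : R) : R :=
  \int[lebesgue_measure]_(t in `]0, +oo[)
    ((\1_`]0, 1[%classic t * `|1 - t| `^ tau + (1 + t) `^ tau - 2)
     / t `^ (1 + 2 * alpha)).

Definition is_tau0 (R : realType) (alpha tau0 : R) : Prop :=
  -1 < tau0 < 0 /\ C_tau alpha tau0 = 0.

(* Main.v *)
Require Import Defs.
From mathcomp Require Import all_boot all_order all_algebra.
From mathcomp Require Import all_classical all_reals all_analysis.
From mathcomp Require Import measurable_realfun ring lra.

Set Implicit Arguments.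
Unset Strict Implicit.
Unset Printing Implicit Defensive.

Import Order.TTheory GRing.Theory Num.Theory.
Import numFieldNormedType.Exports.
Local Open Scope classical_set_scope.
Local Open Scope ring_scope.

(** Write d for the distance to the boundary. In both regimes the solutions
considered behave like d^-s, with s = - gamma - 2 alpha in the weak case and
s = - gamma / p in the strong one, and near the boundary f is at least a
positive multiple of d^-(s + 2 alpha): this is an equality of exponents in the
weak case and follows from gamma < - 2 alpha - 2 alpha / (p - 1) in the strong
one. Since d^-(s + 2 alpha) is the size of the fractional Laplacian of a
function of size d^-s that oscillates at scale d, this lower bound and f >= 0
give positivity and uniqueness ([positive_unique_of_source]).

Positivity ([solution_gt0]). If u <= 0 somewhere, u has a minimum point m in
Omega, and u m <= 0. All second differences at m are nonnegative, whereas the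
equation makes their integral nonpositive. So they vanish and u is almost
everywhere equal to u m <= 0, although u is large on a nonempty open set.

Uniqueness ([solution_le]). Let u and v be two solutions; u / v is bounded, as
both functions have the same rate. Suppose that its supremum k is larger than
1, and let w = u - k v <= 0. Wherever w is so close to 0 that
u^p >= (k + eta) v^p, for some fixed eta > 0, the fractional Laplacian of w,
  - (k - 1) f - (u^p - k v^p),
is below - c d^-(s + 2 alpha). Add to w a bump of height e d(x0)^-s supported
in the ball of radius d(x0) / 2 about x0. If the sum were positive at x0, it
would have a positive maximum in that ball; there the second differences of w
are at most those of the bump up to sign, so the fractional Laplacian of w is
at least - C e d(x0)^-(s + 2 alpha) ([touching_bump], [frac_lap_ge]), which is
absurd when e is small. Hence w <= - e d^-s in all of Omega
([solution_diff_le]), so that u / v <= k - e' for some e' > 0, a contradiction.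

What has to be known about Lebesgue measure is: the integral of
min(|y|^2 / r^2, 1) / |y|^(N + 2 alpha) is at most M r^(- 2 alpha)
([bump_kernel_bound]), null sets are preserved by y |-> c + y and y |-> c - y
([ae_shift], [ae_reflect]), nonempty open sets are not null
([negligible_open_eq0]), and the boundary, where nothing is known about u, is
null ([bdry_negligible]). *)

(** * The Euclidean norm *)

Section euclidean_norm.
Context {R : realType} {n : nat}.
Implicit Types x y z : 'rV[R]_n.

Lemma enorm_ge0 x : 0 <= enorm x.
Proof. exact: sqrtr_ge0. Qed.

Lemma sqr_enorm x : enorm x ^+ 2 = \sum_(i < n) x 0 i ^+ 2.
Proof. by rewrite sqr_sqrtr// sumr_ge0// => i _; exact: sqr_ge0. Qed.

Lemma enormN x : enorm (- x) = enorm x.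
Proof.
by congr Num.sqrt; apply: eq_bigr => i _; rewrite mxE sqrrN.
Qed.

Lemma enorm_distC x y : enorm (x - y) = enorm (y - x).
Proof. by rewrite -enormN opprB. Qed.

Lemma enormZ (c : R) x : enorm (c *: x) = `|c| * enorm x.
Proof.
rewrite /enorm -[`|c|]sqrtr_sqr -sqrtrM ?sqr_ge0//; congr Num.sqrt.
by rewrite mulr_sumr; apply: eq_bigr => i _; rewrite mxE exprMn.
Qed.

Lemma enorm_coord x i : `|x 0 i| <= enorm x.
Proof.
rewrite -[leLHS]sqrtr_sqr ler_sqrt ?sumr_ge0// => [|j _]; last exact: sqr_ge0.
by rewrite (bigD1 i)//= lerDl sumr_ge0// => j _; exact: sqr_ge0.
Qed.

Lemma enorm_eq0 x : enorm x = 0 -> x = 0.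
Proof.
move=> x0; apply/rowP => i; rewrite mxE; apply/eqP.
by rewrite -normr_le0 -x0 enorm_coord.
Qed.

Lemma enorm0 : enorm (0 : 'rV[R]_n) = 0.
Proof. by rewrite -(scale0r 0) enormZ normr0 mul0r. Qed.

Lemma enorm_gt0 x : x != 0 -> 0 < enorm x.
Proof.
move=> x0; rewrite lt_neqAle enorm_ge0 andbT eq_sym.
by apply: contra x0 => /eqP/enorm_eq0 ->.
Qed.

(** Expand the sum of the squares (|y| x_i - |x| y_i)^2. *)
Lemma dot_le_enorm x y : \sum_(i < n) x 0 i * y 0 i <= enorm x * enorm y.
Proof.
have [->|x0] := eqVneq x 0.
  by rewrite enorm0 mul0r big1// => i _; rewrite mxE mul0r.
have [->|y0] := eqVneq y 0.
  by rewrite enorm0 mulr0 big1// => i _; rewrite mxE mulr0.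
have : 0 <= \sum_(i < n) (enorm y * x 0 i - enorm x * y 0 i) ^+ 2.
  by rewrite sumr_ge0// => i _; exact: sqr_ge0.
under eq_bigr do rewrite sqrrB !exprMn.
rewrite big_split/= sumrB -!mulr_sumr -!sqr_enorm.
pose xy2 := enorm x * enorm y *+ 2.
rewrite (eq_bigr (fun i => xy2 * (x 0 i * y 0 i))); last first.
  by move=> i _; rewrite /xy2; ring.
rewrite /xy2 -mulr_sumr; set s := \sum_(i < n) _ => h.
have xy : 0 < enorm x * enorm y by rewrite mulr_gt0 ?enorm_gt0.
rewrite -(ler_pM2l xy); move: h xy; nra.
Qed.

Lemma enormD x y : enorm (x + y) <= enorm x + enorm y.
Proof.
rewrite -ler_sqr ?nnegrE ?addr_ge0 ?enorm_ge0// sqrrD !sqr_enorm.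
under eq_bigr do rewrite mxE sqrrD.
rewrite !big_split/= lerD2r lerD2l -mulr2n lerMn2r/=.
exact: dot_le_enorm.
Qed.

Lemma coord_le_norm x i : `|x 0 i| <= `|x|.
Proof.
rewrite [leRHS]/Num.norm/= mx_normrE.
by apply/bigmax_geP; right => /=; exists (0, i).
Qed.

Lemma norm_le_enorm x : `|x| <= enorm x.
Proof.
rewrite [leLHS]/Num.norm/= mx_normrE; apply/bigmax_leP; split.
  exact: enorm_ge0.
by move=> [j i] _ /=; rewrite (ord1 j); exact: enorm_coord.
Qed.

Lemma enorm_le_norm x : enorm x <= n%:R * `|x|.
Proof.
rewrite -ler_sqr ?nnegrE ?enorm_ge0 ?mulr_ge0// sqr_enorm.
apply: (@le_trans _ _ (\sum_(i < n) `|x| ^+ 2)).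
  apply: ler_sum => i _; rewrite -[leLHS]ger0_norm ?sqr_ge0// normrX.
  by rewrite lerXn2r// ?nnegrE//; exact: coord_le_norm.
rewrite sumr_const card_ord exprMn -[leLHS]mulr_natl ler_wpM2r ?sqr_ge0//.
by rewrite -natrX ler_nat; case: (n) => // k; rewrite leq_pmulr.
Qed.

Lemma enorm_lipschitz x y : `|enorm x - enorm y| <= enorm (x - y).
Proof.
rewrite ler_norml; apply/andP; split.
  by rewrite lerNl opprB lerBlDr enorm_distC -{1}(subrK x y) enormD.
by rewrite lerBlDr -{1}(subrK y x) enormD.
Qed.

End euclidean_norm.

(** * Covers by boxes, null sets and measurable sets *)

Section lebesgue_outer_theory.
Context {R : realType} {n : nat}.
Local Notation outer := (@lebesgue_outer R n).
Local Notation mu := (lebesgue_Rn R n).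
Local Notation lmeasurable := (outer.-cara.-measurable).
Implicit Types (A : set 'rV[R]_n.+1) (ab : 'rV[R]_n.+1 * 'rV[R]_n.+1).
Local Open Scope ereal_scope.

Lemma box_volume_ge0 ab : (0 <= box_volume ab)%R.
Proof. by rewrite prodr_ge0// => i _; rewrite le_max lexx. Qed.

Lemma lebesgue_outer_box_le ab : outer (box ab) <= (box_volume ab)%:E.
Proof.
apply: ereal_inf_lbound => /=.
exists (fun k => if k == 0%N then ab else (0%R, 0%R)).
  by move=> x abx; exists 0%N.
rewrite nneseries_recl// => [|k _]; last by rewrite lee_fin box_volume_ge0.
rewrite eseries0 ?adde0// => -[//|k] _ _ /=; congr EFin.
by rewrite /box_volume big_ord_recl/= subrr maxxx mul0r.
Qed.

(** A map that pulls boxes back into boxes of comparable volume transports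
covers. *)
Lemma lebesgue_outer_preimage_le (T : 'rV[R]_n.+1 -> 'rV[R]_n.+1)
    (g : 'rV[R]_n.+1 * 'rV[R]_n.+1 -> 'rV[R]_n.+1 * 'rV[R]_n.+1) (K : R) A :
  (0 < K)%R ->
  (forall ab x, box ab (T x) -> box (g ab) x) ->
  (forall ab, (box_volume (g ab) <= K * box_volume ab)%R) ->
  outer (T @^-1` A) <= K%:E * outer A.
Proof.
move=> K0 Tg volg; rewrite -lee_pdivrMl//.
apply: le_ereal_inf_tmp => _ [B AB <-]; rewrite lee_pdivrMl//.
apply: (@le_trans _ _ (\sum_(k <oo) (box_volume (g (B k)))%:E)).
  apply: ereal_inf_lbound; exists (g \o B) => // x /AB[k _ Bk].
  by exists k => //; exact: Tg.
rewrite -nneseriesZl//; last by move=> k _; rewrite lee_fin box_volume_ge0.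
apply: lee_nneseries => k _; first by move=> _; rewrite lee_fin box_volume_ge0.
by rewrite -EFinM lee_fin.
Qed.

Lemma negligible_outer A : mu.-negligible A <-> outer A = 0.
Proof.
split=> [[B [mB B0 AB]]|A0].
  apply/eqP; rewrite eq_le outer_measure_ge0 andbT -[leRHS]B0.
  exact: le_outer_measure.
exists A; split => //; apply: le_caratheodory_measurable => X.
rewrite [X in X + _ <= _](_ : _ = 0); last first.
  apply/eqP; rewrite eq_le outer_measure_ge0 andbT -[leRHS]A0.
  by apply: le_outer_measure; exact: subIsetr.
by rewrite add0e; apply: le_outer_measure; exact: subIsetl.
Qed.

Lemma lebesgue_outer_shift c A :
  outer [set x | A (c + x)%R] <= outer A.
Proof.
rewrite -[leRHS]mul1e.
apply: (@lebesgue_outer_preimage_le (fun x => c + x)%R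
  (fun ab => (ab.1 - c, ab.2 - c)%R)) => // ab.
  by move=> x abx i; have := abx i; rewrite /= !mxE lerBlDl ltrBrDl.
rewrite mul1r le_eqVlt; apply/orP; left; apply/eqP/eq_bigr => i _.
by rewrite !mxE opprB addrA subrK.
Qed.

Lemma ae_impl (P Q : 'rV[R]_n.+1 -> Prop) : (forall x, P x -> Q x) ->
  {ae mu, forall x, P x} -> {ae mu, forall x, Q x}.
Proof. by move=> PQ; apply: negligibleS => x; exact: contra_not (PQ x). Qed.

Lemma ae_and (P Q : 'rV[R]_n.+1 -> Prop) :
  {ae mu, forall x, P x} -> {ae mu, forall x, Q x} ->
  {ae mu, forall x, P x /\ Q x}.
Proof.
move=> nP nQ; apply: negligibleS (negligibleU nP nQ) => x /=.
by move=> /not_andP[]; [left|right].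
Qed.

Lemma ae_shift (P : 'rV[R]_n.+1 -> Prop) c :
  {ae mu, forall x, P x} -> {ae mu, forall x, P (c + x)%R}.
Proof.
move=> /negligible_outer P0; apply/negligible_outer.
apply/eqP; rewrite eq_le outer_measure_ge0 andbT -[leRHS]P0.
exact: (@lebesgue_outer_shift c (~` [set x | P x])).
Qed.

Lemma ae_reflect (P : 'rV[R]_n.+1 -> Prop) c :
  {ae mu, forall x, P x} -> {ae mu, forall x, P (c - x)%R}.
Proof.
move=> /negligible_outer P0; apply/negligible_outer.
apply/eqP; rewrite eq_le outer_measure_ge0 andbT.
(* The reflection of [a, b) is (c - b, c - a], which is not half-open on the
   right side; doubling the sides gives the box [c - b, c - b + 2 (b - a)). *)
have <- : (2 ^+ n.+1)%:E * outer (~` [set x | P x]) = 0 by rewrite P0 mule0.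
apply: (@lebesgue_outer_preimage_le (fun x => c - x)%R
  (fun ab => (c - ab.2, c - ab.2 + (ab.2 - ab.1) *+ 2)%R)) => // ab.
  move=> x abx i; have := abx i; rewrite /= !mxE; set a := ab.1 _ _.
  by set b := ab.2 _ _ => /andP[? ?]; apply/andP; split; lra.
rewrite le_eqVlt; apply/orP; left; apply/eqP.
rewrite /box_volume -[X in (2 ^+ X)%R](card_ord n.+1) -prodr_const -big_split/=.
apply: eq_bigr => i _; rewrite !mxE.
set a := ab.1 _ _; set b := ab.2 _ _.
rewrite [X in Num.max _ X = _](_ : _ = 2 * (b - a))%R; last by ring.
by rewrite -[X in Num.max X _](mulr0 (2 : R)%R) -maxr_pMr.
Qed.

Lemma box_cut (i : 'I_n.+1) (c : R) ab :
  exists lu : ('rV[R]_n.+1 * 'rV[R]_n.+1) * ('rV[R]_n.+1 * 'rV[R]_n.+1),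
  [/\ forall x, box ab x -> (x ord0 i < c)%R -> box lu.1 x,
      forall x, box ab x -> (c <= x ord0 i)%R -> box lu.2 x &
      (box_volume lu.1 + box_volume lu.2 = box_volume ab)%R].
Proof.
pose m := \row_j (if j == i then Num.min (ab.2 ord0 j) c else ab.2 ord0 j)%R.
pose M := \row_j (if j == i then Num.max (ab.1 ord0 j) c else ab.1 ord0 j)%R.
exists ((ab.1, m), (M, ab.2)); split => /=.
- move=> x abx xc j; have := abx j; rewrite /= !mxE.
  by case: eqP => // ->; rewrite lt_min xc andbT.
- move=> x abx xc j; have := abx j; rewrite /= !mxE.
  by case: eqP => // ->; rewrite ge_max xc andbT.
rewrite /box_volume !(@bigD1 _ _ _ _ i xpredT)//= !mxE eqxx.
pose width j := Num.max 0%R (ab.2 ord0 j - ab.1 ord0 j)%R.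
rewrite [X in (_ * X + _)%R](eq_bigr width); last first.
  by move=> j /negPf ji; rewrite mxE ji.
rewrite [X in (_ + _ * X)%R](eq_bigr width); last first.
  by move=> j /negPf ji; rewrite mxE ji.
rewrite -mulrDl; congr (_ * _)%R.
set a := ab.1 _ _; set b := ab.2 _ _.
rewrite /Num.min /Num.max.
by case: (ltP b c); case: (ltP a c) => ? ?; repeat case: ifPn;
  rewrite -?leNgt => *; lra.
Qed.

(** Cutting every box of a cover along the hyperplane preserves the total
volume ([box_cut]); this is Caratheodory's criterion. *)
Lemma halfspace_measurable (i : 'I_n.+1) (c : R) :
  lmeasurable [set x | (x ord0 i < c)%R].
Proof.
apply: le_caratheodory_measurable => X; apply: le_ereal_inf_tmp => _ [B XB <-].
have /choice[lu lu_cut] k := box_cut i c (B k).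
apply: (@le_trans _ _ (\sum_(k <oo) (box_volume (lu k).1)%:E +
                       \sum_(k <oo) (box_volume (lu k).2)%:E)).
  apply: leeD; apply: ereal_inf_lbound.
    exists (fun k => (lu k).1) => // x [/XB[k _ Bk] xc]; exists k => //.
    by have [+ _ _] := lu_cut k; exact.
  exists (fun k => (lu k).2) => // x [/XB[k _ Bk] /negP xc]; exists k => //.
  by have [_ + _] := lu_cut k; apply => //; rewrite leNgt.
rewrite -nneseriesD; last 2 first.
- by move=> k _ _; rewrite lee_fin box_volume_ge0.
- by move=> k _ _; rewrite lee_fin box_volume_ge0.
apply: lee_nneseries => k _.
  by move=> _; rewrite adde_ge0// lee_fin box_volume_ge0.
by have [_ _ <-] := lu_cut k; rewrite EFinD.
Qed.

Lemma box_measurable ab : lmeasurable (box ab).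
Proof.
have -> : box ab = \bigcap_(i in [set: 'I_n.+1])
    (~` [set x : 'rV_n.+1 | (x ord0 i < ab.1 ord0 i)%R] `&`
     [set x : 'rV_n.+1 | (x ord0 i < ab.2 ord0 i)%R]).
  apply/seteqP; split => [x abx i _|x abx i].
    by have /andP[ax xb] := abx i; split => //=; apply/negP; rewrite -leNgt.
  by have [/negP + ->] := abx i I; rewrite -leNgt => ->.
apply: fin_bigcap_measurable => // i _.
apply: measurableI; last exact: halfspace_measurable.
by apply: measurableC; exact: halfspace_measurable.
Qed.

(** These countably many boxes play the role of a base of the topology, although
half-open boxes are not open. *)
Definition rat_box (q : 'rV[rat]_n.+1 * 'rV[rat]_n.+1) : set 'rV[R]_n.+1 :=
  box (map_mx ratr q.1, map_mx ratr q.2).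

Lemma rat_box_nbhs (x : 'rV[R]_n.+1) (U : set 'rV[R]_n.+1) :
  nbhs x U -> exists2 q, rat_box q x & rat_box q `<=` U.
Proof.
move=> /nbhs_ballP[e /= e0 xeU].
have lo i : exists q : rat, (x ord0 i - e < ratr q < x ord0 i)%R.
  have /rat_in_itvoo[q] : (x ord0 i - e < x ord0 i)%R by rewrite ltrBlDr ltrDl.
  by exists q; move: p; rewrite in_itv/=.
have hi i : exists q : rat, (x ord0 i < ratr q < x ord0 i + e)%R.
  have /rat_in_itvoo[q] : (x ord0 i < x ord0 i + e)%R by rewrite ltrDl.
  by exists q; move: p; rewrite in_itv/=.
have /choice[a ax] := lo; have /choice[b xb] := hi.
exists (\row_i a i, \row_i b i).
  move=> i; rewrite /= !mxE; have := ax i; have := xb i.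
  by move=> /andP[-> _] /andP[_ /ltW->].
move=> y yab; apply: xeU; rewrite mx_norm_ball /ball_/=.
apply: (@le_lt_trans _ _ (mx_norm (x - y))) => //.
rewrite mx_normrE; apply/bigmax_ltP; split => // -[j i] _ /=.
rewrite (ord1 j) !mxE; have := yab i; have := ax i; have := xb i.
rewrite /= !mxE => /andP[? ?] /andP[? ?] /andP[? ?].
by rewrite ltr_norml; apply/andP; split; lra.
Qed.

Lemma open_measurable A : open A -> lmeasurable A.
Proof.
move=> oA; have -> : A = \bigcup_q
    (if `[< rat_box q `<=` A >] then rat_box q else set0).
  apply/seteqP; split => [x Ax|x [q _]]; last by case: asboolP => // qA /qA.
  have [q qx qA] := rat_box_nbhs (open_nbhs_nbhs (conj oA Ax)).
  by exists q => //; case: asboolP.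
apply: countable_bigcupT_measurable => [|q]; first exact: countableP.
by case: asboolP => // _; exact: box_measurable.
Qed.

(** A Lindelof argument: the rational boxes that meet A in a null set cover
A. *)
Lemma negligible_local A :
  (forall x, A x -> exists2 U, nbhs x U & mu.-negligible (A `&` U)) ->
  mu.-negligible A.
Proof.
move=> locA.
pose D q := mu.-negligible (A `&` rat_box q).
pose F k := if unpickle k is Some q then
  if `[< D q >] then A `&` rat_box q else set0 else set0.
have : mu.-negligible (\bigcup_k F k).
  apply: negligible_bigcup => k; rewrite /F.
  case: unpickle => [q|]; last exact: negligible_set0.
  by case: asboolP => // _; exact: negligible_set0.
apply: negligibleS => x Ax; have [U /rat_box_nbhs[q qx qU] AU0] := locA x Ax.
exists (pickle q) => //; rewrite /F pickleK; case: asboolP => // nDq.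
by exfalso; apply: nDq; apply: negligibleS AU0; exact: setIS.
Qed.

End lebesgue_outer_theory.

(** * Lower bound for the measure of a box *)

Section lebesgue_outer_box.
Context {R : realType}.
Local Open Scope ereal_scope.

Lemma weighted_cover_measure d (T : measurableType d)
    (mu : {measure set T -> \bar R}) (D : set T) (E : (set T)^nat)
    (w : nat -> R) (c : R) :
  measurable D -> (forall k, measurable (E k)) -> (forall k, 0 <= w k)%R ->
  (0 <= c)%R ->
  (forall t, D t -> c%:E <= \sum_(k <oo) (w k)%:E * (\1_(E k) t)%:E) ->
  c%:E * mu D <= \sum_(k <oo) (w k)%:E * mu (E k).
Proof.
move=> mD mE w0 c0 cle.
have mi k : measurable_fun D (fun t => (\1_(E k) t)%:E : \bar R).
  by apply/measurable_EFinP; exact: measurable_indic.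
have mf k : measurable_fun D (fun t => (w k)%:E * (\1_(E k) t)%:E).
  exact: measurable_funeM.
have f0 k t : D t -> 0 <= (w k)%:E * (\1_(E k) t)%:E.
  by move=> _; rewrite mule_ge0 ?lee_fin.
apply: (@le_trans _ _
    (\int[mu]_(t in D) \sum_(k <oo) (w k)%:E * (\1_(E k) t)%:E)).
  rewrite -integral_cst//; apply: ge0_le_integral => //.
  by apply: (@ge0_emeasurable_sum _ _ _ _ _ xpredT) => // k t /f0.
rewrite integral_nneseries//; apply: lee_nneseries => k _.
  by move=> _; apply: integral_ge0; exact: f0.
rewrite ge0_integralZl ?lee_fin//.
rewrite integral_indic//; apply: lee_wpmul2l; first by rewrite lee_fin.
by apply: le_measure; rewrite ?inE//; exact: measurableI.
Qed.

(** The one-dimensional step of [cover_box_volume]: the weights stand for the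
coordinates that are not integrated at this step. *)
Lemma weighted_cover_itv (a b c : R) (A B w : nat -> R) :
  (0 <= c)%R -> (a < b)%R -> (forall k, 0 <= w k)%R ->
  (forall t, (a <= t < b)%R ->
    c%:E <= \sum_(k <oo) (w k * (A k <= t < B k)%R%:R)%:E) ->
  (c * (b - a))%:E <= \sum_(k <oo) (w k * Num.max 0 (B k - A k))%:E.
Proof.
move=> c0 ab w0 cle.
have := @weighted_cover_measure _ _ (@lebesgue_measure R) `[a, b[%classic
  (fun k => `[A k, B k[%classic) w c (measurable_itv _)
  (fun k => measurable_itv _) w0 c0.
rewrite /= lebesgue_measure_itv/= lte_fin ab -EFinB -EFinM => h.
apply: (le_trans (h _)).
  move=> t; rewrite /= in_itv/= => /cle/le_trans; apply.
  rewrite le_eqVlt; apply/orP; left; apply/eqP/eq_eseriesr => k _.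
  by rewrite indicE mem_setE in_itv/= EFinM.
apply: lee_nneseries => k _.
  by move=> _; rewrite mule_ge0 ?lee_fin.
rewrite EFinM; apply: lee_wpmul2l; first by rewrite lee_fin.
rewrite lebesgue_measure_itv/= lte_fin; case: ifPn => _.
  by rewrite -EFinB lee_fin le_max lexx orbT.
by rewrite lee_fin le_max lexx.
Qed.

(** That covers have at least the volume of the box is Fubini's theorem for
products of intervals: the inequality 1 <= sum of the indicator functions is
integrated in one coordinate after the other. Points are functions on nat, so
that changing one coordinate is easy. *)
Lemma cover_box_volume (N : nat) (a b : nat -> R) (A B : nat -> nat -> R) :
  (forall i, (i < N)%N -> (a i < b i)%R) ->
  (forall x : nat -> R, (forall i, (i < N)%N -> (a i <= x i < b i)%R) ->
    exists k, forall i, (i < N)%N -> (A k i <= x i < B k i)%R) ->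
  (\prod_(0 <= i < N) (b i - a i))%:E <=
    \sum_(k <oo) (\prod_(0 <= i < N) Num.max 0 (B k i - A k i))%:E.
Proof.
move=> ab cov.
pose V k i := (Num.max 0 (B k i - A k i))%R.
pose J k i t := ((A k i <= t < B k i)%R%:R : R).
have V0 k i : (0 <= V k i)%R by rewrite /V le_max lexx.
(* The last j coordinates have been integrated, the others are frozen at x. *)
suff H j : (j <= N)%N -> forall x : nat -> R,
    (forall i, (i < N - j)%N -> (a i <= x i < b i)%R) ->
    (\prod_(N - j <= i < N) (b i - a i))%:E <=
      \sum_(k <oo) (\prod_(0 <= i < N - j) J k i (x i) *
                   \prod_(N - j <= i < N) V k i)%:E.
  have := H N (leqnn _) (fun=> 0%R); rewrite subnn => /(_ _)/le_trans -> //.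
  apply: lee_nneseries => k _; last by rewrite big_geq// mul1r.
  by move=> _; rewrite lee_fin mulr_ge0// prodr_ge0.
elim: j => [_ x xab|j IH jN x xab].
  rewrite subn0 in xab *; have [k xk] := cov x xab.
  rewrite (@nneseriesD1 R _ k)//; last first.
    by move=> i _; rewrite lee_fin mulr_ge0// prodr_ge0.
  rewrite !(big_geq (leqnn N)) mulr1 big_nat big1.
    rewrite leeDl// nneseries_ge0// => i _ _.
    by rewrite lee_fin mulr_ge0// prodr_ge0.
  by move=> i /andP[_ iN]; rewrite /J xk.
set m := (N - j.+1)%N in xab *.
have mN : (m < N)%N by rewrite /m ltn_subrL/= (leq_trans _ jN).
have mE : (N - j)%N = m.+1 by rewrite /m subnS prednK// subn_gt0.
rewrite mE in IH.
rewrite big_ltn// mulrC.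
under eq_eseriesr do
  rewrite [X in (_ * X)%R]big_ltn// [X in (_ * X)%R]mulrC mulrA.
apply: weighted_cover_itv => [||k|t tab].
- by rewrite big_nat prodr_ge0// => i /andP[_ iN]; rewrite subr_ge0 ltW ?ab.
- exact: ab.
- by rewrite mulr_ge0// prodr_ge0.
pose y i := if i == m then t else x i.
have := IH (ltnW jN) y; move=> h; apply: (le_trans (h _)).
  move=> i; rewrite ltnS leq_eqVlt /y; case: eqP => [-> _//|_ /= im].
  exact: xab.
rewrite le_eqVlt; apply/orP; left; apply/eqP/eq_eseriesr => k _; congr EFin.
rewrite big_nat_recr//= /y eqxx -/(J k m t) mulrAC; congr (_ * _ * _)%R.
rewrite !big_nat; apply: eq_bigr => i /= im.
by rewrite (ltn_eqF im).
Qed.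

Lemma lebesgue_outer_box_ge n (ab : 'rV[R]_n.+1 * 'rV[R]_n.+1) :
  (forall i, ab.1 ord0 i < ab.2 ord0 i)%R ->
  (box_volume ab)%:E <= lebesgue_outer (box ab).
Proof.
move=> ablt; apply: le_ereal_inf_tmp => _ [B cov <-].
have volE (cd : 'rV[R]_n.+1 * 'rV[R]_n.+1) : box_volume cd =
    (\prod_(0 <= i < n.+1)
      Num.max 0 (cd.2 ord0 (inord i) - cd.1 ord0 (inord i)))%R.
  by rewrite big_mkord; apply: eq_bigr => i _; rewrite inord_val.
rewrite volE; under eq_eseriesr do rewrite volE.
pose width i := (ab.2 ord0 (inord i) - ab.1 ord0 (inord i))%R.
rewrite (eq_bigr width); last first.
  by move=> i _; rewrite max_r// subr_ge0 ltW.
apply: (@cover_box_volume n.+1 (fun i => ab.1 ord0 (inord i))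
  (fun i => ab.2 ord0 (inord i)) (fun k i => (B k).1 ord0 (inord i))
  (fun k i => (B k).2 ord0 (inord i))) => [//|x xab].
have [|k _ Bk] := cov (\row_i x i).
  by move=> i; rewrite mxE -{1 4}(inord_val i); exact: xab.
by exists k => i iN; have := Bk (inord i); rewrite mxE inordK.
Qed.

Lemma negligible_open_eq0 n (A : set 'rV[R]_n.+1) :
  open A -> (lebesgue_Rn R n).-negligible A -> A = set0.
Proof.
move=> oA /negligible_outer A0; rewrite -subset0 => x Ax.
have [e/= e0 xeA] := (nbhs_ballP _ _).1 (open_nbhs_nbhs (conj oA Ax)).
pose ab := (x, x + const_mx e)%R : 'rV[R]_n.+1 * 'rV[R]_n.+1.
have : (box_volume ab)%:E <= 0.
  rewrite -[leRHS]A0; apply: (@le_trans _ _ (lebesgue_outer (box ab))).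
    by apply: lebesgue_outer_box_ge => i; rewrite /= !mxE ltrDl.
  apply: le_outer_measure => y yab; apply: xeA; rewrite mx_norm_ball /ball_/=.
  apply: (@le_lt_trans _ _ (mx_norm (x - y)%R)) => //.
  rewrite mx_normrE; apply/bigmax_ltP; split => // -[j i] _ /=.
  rewrite (ord1 j) !mxE; have := yab i; rewrite /= !mxE => /andP[? ?].
  by rewrite ltr_norml; apply/andP; split; lra.
rewrite lee_fin leNgt => /negP[]; apply: prodr_gt0 => i _.
by rewrite !mxE addrAC subrr add0r lt_max e0 orbT.
Qed.

End lebesgue_outer_box.

(** * The boundary of a C^2 domain is null *)

Section null_boundary.
Context {R : realType} {n : nat}.
Local Notation outer := (@lebesgue_outer R n).
Local Notation mu := (lebesgue_Rn R n).
Local Notation lmeasurable := (outer.-cara.-measurable).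
Implicit Types (A G : set 'rV[R]_n.+1) (c x : 'rV[R]_n.+1).

Lemma lebesgue_outer_shiftE c A : outer [set x | A (c + x)] = outer A.
Proof.
apply/eqP; rewrite eq_le lebesgue_outer_shift/=.
rewrite -[X in (X <= _)%E](_ :
    outer [set x | [set y | A (c + y)] (- c + x)] = _).
  exact: lebesgue_outer_shift.
by congr outer; apply/seteqP; split => x /=; rewrite addrA subrr add0r.
Qed.

Lemma measurable_shift c A : lmeasurable A -> lmeasurable [set x | A (c + x)].
Proof.
move=> mA; change (outer.-caratheodory [set x | A (c + x)]) => X.
have cA : outer.-caratheodory A := mA; set Y := [set y | X (y - c)].
have shiftY Z : [set x | [set y | Z (y - c)] (c + x)] = Z.
  by apply/seteqP; split => x /=; rewrite addrC addKr.
have -> : outer X = outer Y by rewrite -(lebesgue_outer_shiftE c Y) shiftY.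
rewrite cA -(lebesgue_outer_shiftE c (Y `&` A)).
rewrite -(lebesgue_outer_shiftE c (Y `&` ~` A)).
have restr B : [set x | (Y `&` B) (c + x)] = X `&` [set x | B (c + x)].
  by apply/seteqP; split => x; rewrite /Y/= [c + x]addrC addrK.
by rewrite !restr.
Qed.

(** The translates of G by 1, 1/2, 1/3, ... along the axis i are disjoint, have
the same measure, and lie in a common box. *)
Lemma graph_negligible G (i : 'I_n.+1) ab :
  lmeasurable G -> G `<=` box ab ->
  (forall x t, G x -> G (t *: delta_mx 0 i + x) -> t = 0) ->
  mu.-negligible G.
Proof.
move=> mG Gab Gi.
pose F (k : nat) := [set x | G (k.+1%:R^-1 *: delta_mx 0 i + x)].
have mF k : lmeasurable (F k) by exact: measurable_shift.
have tF : trivIset setT F.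
  apply/trivIsetP => j k _ _ /eqP jk; rewrite -subset0 => x [Fj Fk]; apply: jk.
  have : G ((k.+1%:R^-1 - j.+1%:R^-1) *: delta_mx 0 i +
            (j.+1%:R^-1 *: delta_mx 0 i + x)).
    by rewrite addrA -scalerDl subrK.
  move/(Gi _ _ Fj)/eqP; rewrite subr_eq0 => /eqP/invr_inj/eqP.
  by rewrite eqr_nat => /eqP[].
have muF k : mu (F k) = outer G by exact: lebesgue_outer_shiftE.
pose cd := (ab.1 - const_mx 1, ab.2).
have Fcd : \bigcup_k F k `<=` box cd.
  move=> x [k _ /Gab xab] j; have := xab j; rewrite /= !mxE.
  have k0 : 0 <= (k.+1%:R : R)^-1 by rewrite invr_ge0.
  have k1 : (k.+1%:R : R)^-1 <= 1 by rewrite invf_le1// ler1n.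
  rewrite eqxx; case: (_ == i); rewrite /= ?mulr0 ?mulr1 => /andP[];
    move: k0 k1; move: (k.+1%:R^-1 : R) => q q0 q1 xa xb;
    by apply/andP; split; lra.
have cdV : (mu (\bigcup_k F k) <= (box_volume cd)%:E)%E.
  apply: le_trans (lebesgue_outer_box_le cd).
  exact: le_outer_measure Fcd.
have outerGm m : (m%:R%:E * outer G <= (box_volume cd)%:E)%E.
  apply: le_trans cdV; rewrite measure_bigcup//=.
  rewrite -[X in (X <= _)%E](_ : (\sum_(0 <= k < m) mu (F k))%E = _).
    have F0 k : (0 <= k)%N -> xpredT k -> (0 <= mu (F k))%E by [].
    apply: le_trans (@nneseries_lim_ge R _ xpredT 0%N m F0) _.
    rewrite le_eqVlt; apply/orP; left; apply/eqP/eq_eseriesl => k.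
    by rewrite in_setT.
  under eq_bigr do rewrite muF.
  by rewrite sumr_const_nat subn0 mule_natl.
apply/negligible_outer; apply/eqP; rewrite eq_le outer_measure_ge0 andbT leNgt.
apply/negP => G0.
have Gfin : outer G \is a fin_num.
  rewrite ge0_fin_numE ?outer_measure_ge0// ltey; apply/eqP => Goo.
  by have := outerGm 1%N; rewrite Goo mul1e leye_eq.
move: G0 outerGm; rewrite -(fineK Gfin); set g := fine _.
rewrite lte_fin => g0 gV.
have := gV (Num.truncn (box_volume cd / g)).+1.
rewrite -EFinM lee_fin -ler_pdivlMr// leNgt truncnS_gt//.
Qed.

Lemma continuous_col' (i : 'I_n.+1) :
  continuous (col' i : 'rV[R]_n.+1 -> 'rV[R]_n).
Proof.
move=> x U /nbhs_ballP[e e0 eU].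
apply/(@nbhs_ballP _ _ x); exists e => //= y [_ xy]; apply: eU.
by split => // j k; rewrite !mxE; exact: xy.
Qed.

Lemma enorm_ball_nbhs x (r : R) : 0 < r -> nbhs x [set y | enorm (y - x) < r].
Proof.
move=> r0; apply/nbhs_ballP; exists (r / n.+1%:R) => /=.
  by rewrite divr_gt0.
move=> y; rewrite mx_norm_ball /ball_/= => xy.
rewrite enorm_distC (le_lt_trans (enorm_le_norm _))//.
by rewrite mulrC -ltr_pdivlMr.
Qed.

(** Locally, the boundary lies on the graph of a continuous function, because
Omega or the interior of its complement contains the points off that graph. *)
Lemma bdry_negligible Omega : C2_domain Omega ->
  mu.-negligible (bdry Omega).
Proof.
move=> C2; apply: negligible_local => x0.
move=> /C2[i [s [r [phi [r0 [phiC _] Ophi]]]]].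
have [e e0 ballr] : exists2 e : R, 0 < e &
    forall x, ball x0 e x -> enorm (x - x0) < r.
  by have /nbhs_ballP[e /= e0 eU] := enorm_ball_nbhs x0 r0; exists e.
exists (ball x0 e); first exact: nbhsx_ballx.
pose h (x : 'rV[R]_n.+1) := x 0 i - phi (col' i x).
pose g x := (-1) ^+ s * h x.
have gC : continuous g.
  move=> x; apply: (@continuousM R _ (cst ((-1) ^+ s)) h x).
    exact: cst_continuous.
  apply: (@continuousB R R _ (fun y : 'rV[R]_n.+1 => y 0 i) (phi \o col' i) x).
    exact: coord_continuous.
  apply: (@continuous_comp _ _ _ (col' i) phi x); first exact: continuous_col'.
  exact: (continuous_subspace_setT phi).2 phiC _.
have graph x : bdry Omega x -> enorm (x - x0) < r -> x 0 i = phi (col' i x).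
  move=> [clx nintx] xr.
  have xU : nbhs x [set y | enorm (y - x0) < r].
    have := enorm_ball_nbhs x (_ : 0 < r - enorm (x - x0)).
    rewrite subr_gt0 => /(_ xr); apply: filterS => y /=; rewrite ltrBrDr.
    by apply: le_lt_trans; rewrite -{1}(subrK x y) -addrA enormD.
  suff : g x == 0 by rewrite /g /h mulf_eq0 signr_eq0/= subr_eq0 => /eqP.
  case: (ltgtP (g x) 0) => // gx0; exfalso.
  - have [|y [Oy [gy yr]]] :=
        clx ([set y | g y < 0] `&` [set y | enorm (y - x0) < r]).
      apply: filterI => //; exact: (gC x _ (lt_nbhsl gx0)).
    by have := (Ophi y yr).1 Oy; rewrite -/(g y) ltNge ltW.
  - apply: nintx.
    have xV : nbhs x ([set y | enorm (y - x0) < r] `&` [set y | 0 < g y]).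
      apply: filterI => //; exact: (gC x _ (lt_nbhsr gx0)).
    by rewrite /interior/=; apply: filterS xV => y [yr gy]; apply/(Ophi y yr).
apply: (@graph_negligible _ i (x0 - const_mx e, x0 + const_mx e)).
- apply: measurableI; last by apply: open_measurable; exact: ball_open.
  apply: measurableD; last by apply: open_measurable; exact: open_interior.
  rewrite -[X in measurable X]setCK; apply: measurableC.
  by apply: open_measurable; rewrite openC; exact: closed_closure.
- move=> x [_ [_ xe] j]; have := xe 0 j; rewrite /ball/= !mxE.
  by rewrite ltr_norml => /andP[? ?]; apply/andP; split; lra.
- move=> x t [bx /ballr xr] [by' /ballr yr].
  have := graph _ by' yr.
  rewrite (_ : col' i _ = col' i x); last first.
    apply/rowP => j.
    by rewrite !mxE eq_sym (negPf (neq_lift _ _)) andbF mulr0 add0r.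
  rewrite -(graph _ bx xr) !mxE !eqxx/= mulr1 => /eqP.
  by rewrite -subr_eq0 addrK => /eqP.
Qed.

End null_boundary.

(** * The integral of the truncated kernel *)

Section kernel_bound.
Context {R : realType} {n : nat}.
Local Notation mu := (lebesgue_Rn R n).
Local Notation T := (caratheodory_type (@lebesgue_outer R n)).
Local Notation N := n.+1.
Implicit Types (y : 'rV[R]_n.+1) (s t r : R).

Definition cube s : set 'rV[R]_n.+1 := box (const_mx (- s), const_mx s).

Lemma cube_measure_le s : 0 <= s -> (mu (cube s) <= ((2 * s) ^+ N)%:E)%E.
Proof.
move=> s0; apply: le_trans (lebesgue_outer_box_le _) _.
rewrite lee_fin /box_volume -[X in _ ^+ X](card_ord N) -prodr_const.
rewrite le_eqVlt; apply/orP; left; apply/eqP/eq_bigr => i _.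
by rewrite !mxE max_r; lra.
Qed.

Lemma mem_cube s y : enorm y < s -> cube s y.
Proof.
move=> ys i; have := le_lt_trans (enorm_coord y i) ys.
by rewrite /= !mxE ltr_norml => /andP[/ltW-> ->].
Qed.

(** Step functions of this kind dominate the truncated kernel: they are
measurable and their integrals are bounded by volumes of boxes, so that neither
polar coordinates nor the scaling of Lebesgue measure come in. *)
Definition cube_series (w s : nat -> R) (y : T) : \bar R :=
  (\sum_(k <oo) (w k)%:E * (\1_(cube (s k)) y)%:E)%E.

Lemma cube_series_ge0 (w s : nat -> R) y : (forall k, 0 <= w k) ->
  (0 <= cube_series w s y)%E.
Proof.
by move=> w0; apply: nneseries_ge0 => k _ _; rewrite mule_ge0 ?lee_fin.
Qed.

Lemma cube_series_ge (w s : nat -> R) y k : (forall k, 0 <= w k) ->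
  cube (s k) y -> ((w k)%:E <= cube_series w s y)%E.
Proof.
move=> w0 sk; rewrite /cube_series (@nneseriesD1 R _ k)//; last first.
  by move=> i _; rewrite mule_ge0 ?lee_fin.
rewrite indicE mem_set// mule1 leeDl// nneseries_ge0// => i _ _.
by rewrite mule_ge0 ?lee_fin.
Qed.

Let measurable_cube_term (w s : nat -> R) k :
  measurable_fun setT (fun y : T => ((w k)%:E * (\1_(cube (s k)) y)%:E)%E).
Proof.
apply: measurable_funeM; apply/measurable_EFinP.
by apply: measurable_indic; exact: box_measurable.
Qed.

Lemma measurable_cube_series (w s : nat -> R) : (forall k, 0 <= w k) ->
  measurable_fun setT (cube_series w s).
Proof.
move=> w0; apply: (@ge0_emeasurable_sum _ _ _ _ _ xpredT) => // k y _ _.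
by rewrite mule_ge0 ?lee_fin.
Qed.

Lemma integral_cube_series_le (w s : nat -> R) (C q : R) :
  (forall k, 0 <= w k) -> (forall k, 0 <= s k) -> 0 < q < 1 ->
  (forall k, w k * (2 * s k) ^+ N <= C * q ^+ k) ->
  (\int[mu]_y cube_series w s y <= (C / (1 - q))%:E)%E.
Proof.
move=> w0 s0 /andP[q0 q1] wC.
rewrite /cube_series integral_nneseries//; last first.
  by move=> k y _; rewrite mule_ge0 ?lee_fin.
apply: (@le_trans _ _ (\sum_(k <oo) (C * q ^+ k)%:E)%E).
  apply: lee_nneseries => k _.
    by move=> _; apply: integral_ge0 => y _; rewrite mule_ge0 ?lee_fin.
  rewrite ge0_integralZl ?lee_fin//; last first.
    by apply/measurable_EFinP/measurable_indic; exact: box_measurable.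
  rewrite integral_indic//; last exact: box_measurable.
  rewrite setIT; apply: le_trans (_ : _ <= ((w k * (2 * s k) ^+ N)%:E))%E _.
    by rewrite EFinM; apply: lee_wpmul2l; rewrite ?lee_fin// cube_measure_le.
  by rewrite lee_fin.
have cvgq : series (geometric C q) @ \oo --> C / (1 - q).
  by apply: cvg_geometric_series; rewrite ger0_norm// ltW.
suff -> : (\sum_(k <oo) (C * q ^+ k)%:E = (C / (1 - q))%:E)%E by [].
apply/cvg_lim => //.
rewrite (_ : (fun m => _) = EFin \o series (geometric C q)).
  by apply: cvg_EFin => //; exact: nearW.
by apply/funext => m; rewrite /= /series/= sumEFin.
Qed.

(** The left-hand side is a bound for the kernel on the shell
r t / 2 <= |y| < r t times the volume of the cube of half-side r t. Both
factors are powers of r t apart from the truncation, which explains the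
homogeneity in r. *)
Lemma dyadic_weight (d r t : R) : 0 < r -> 0 < t ->
  Num.min (t ^+ 2) 1 / (r * t / 2) `^ (N%:R + d) * (2 * (r * t)) ^+ N =
  4 ^+ N * 2 `^ d * r `^ (- d) * (Num.min (t ^+ 2) 1 * t `^ (- d)).
Proof.
move=> r0 t0; have rt0 : 0 < r * t by rewrite mulr_gt0.
have z0 : 0 < r * t / 2 by rewrite divr_gt0.
rewrite powRD; last by apply/implyP => _; rewrite gt_eqF.
rewrite powR_mulrn; last exact: ltW.
have -> : 2 * (r * t) = 4 * (r * t / 2) by field.
rewrite [(4 * _) ^+ N]exprMn powRM ?invr_ge0 ?(ltW rt0)// powRM ?ltW// !powRN.
have -> : (2^-1 : R) `^ d = (2 `^ d)^-1.
  by rewrite -powR_inv1// -powRrM mulN1r powRN.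
have zN : (r * t / 2) ^+ N != 0 by rewrite expf_neq0// gt_eqF.
have rd : r `^ d != 0 by rewrite gt_eqF// powR_gt0.
have td : t `^ d != 0 by rewrite gt_eqF// powR_gt0.
have twod : (2 : R) `^ d != 0 by rewrite gt_eqF// powR_gt0.
move: (_ ^+ N) zN (4 ^+ N) => Z zN W.
by field; rewrite zN rd td twod.
Qed.

Lemma dyadic_shell (z r : R) : 0 < z -> 0 < r ->
  exists k, r * 2 ^+ k <= z < r * 2 ^+ k.+1 \/
            r / 2 ^+ k.+1 <= z < r / 2 ^+ k.
Proof.
move=> z0 r0.
have pow2 (c : R) : exists k : nat, c < 2 ^+ k.+1.
  exists (Num.truncn c).+1; apply: (lt_trans (truncnS_gt c)).
  by rewrite -natrX ltr_nat (ltn_trans (ltn_expl _ (leqnn 2)))// ltn_exp2l.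
have [zr|rz] := ltP z r.
- have ex : exists k, r / 2 ^+ k.+1 <= z.
    have [k rzk] := pow2 (r / z); exists k.
    by rewrite ler_pdivrMr ?exprn_gt0// mulrC -ler_pdivrMr// ltW.
  case: (ex_minnP ex) => k kz kmin; exists k; right; rewrite kz/=.
  case: k => [|k] in kz kmin *; first by rewrite expr0 divr1.
  by rewrite ltNge; apply/negP => /kmin; rewrite ltnn.
- have ex : exists k, z < r * 2 ^+ k.+1.
    have [k rzk] := pow2 (z / r); exists k.
    by rewrite mulrC -ltr_pdivrMr.
  case: (ex_minnP ex) => k kz kmin; exists k; left; rewrite kz andbT.
  case: k => [|k] in kz kmin *; first by rewrite expr0 mulr1.
  by rewrite leNgt; apply/negP => /kmin; rewrite ltnn.
Qed.

Lemma shell_weight (e r t z : R) : 0 <= e -> 0 < r -> 0 < t ->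
  r * t / 2 <= z < r * t ->
  Num.min (z ^+ 2 / r ^+ 2) 1 / z `^ e <=
  Num.min (t ^+ 2) 1 / (r * t / 2) `^ e.
Proof.
move=> e0 r0 t0 /andP[rz zr].
have z20 : 0 < r * t / 2 by rewrite divr_gt0// mulr_gt0.
have z0 := lt_le_trans z20 rz.
apply: ler_pM.
- by rewrite le_min ler01 andbT divr_ge0// sqr_ge0.
- by rewrite invr_ge0 powR_ge0.
- rewrite le_min !ge_min lexx orbT andbT; apply/orP; left.
  rewrite -expr_div_n ler_sqr ?nnegrE ?divr_ge0 ?ltW//.
  by rewrite ltr_pdivrMr// mulrC.
- rewrite lef_pV2 ?posrE ?powR_gt0//.
  by rewrite ge0_ler_powR// nnegrE ltW.
Qed.

(** The cubes have half-sides r 2^(k + 1) and r 2^-k. By [dyadic_weight], the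
terms are at most r^-d times those of geometric series of ratios 2^-d and
2^(d - 2), where d = 2 alpha; both ratios are less than 1 as 0 < d < 2. *)
Lemma bump_kernel_bound (alpha : R) : 0 < alpha < 1 ->
  exists2 M : R, 0 < M & forall r, 0 < r -> exists G : T -> \bar R,
    [/\ measurable_fun setT G, forall y, (0 <= G y)%E,
      forall y : 'rV[R]_n.+1, y != 0 ->
        ((Num.min (enorm y ^+ 2 / r ^+ 2) 1 /
          enorm y `^ (N%:R + 2 * alpha))%:E <= G y)%E
      & (\int[mu]_y G y <= (M * r `^ (- (2 * alpha)))%:E)%E].
Proof.
move=> /andP[a0 a1]; set d := 2 * alpha.
have d0 : 0 < d by rewrite mulr_gt0.
have d2 : d < 2 by rewrite /d; lra.
pose e : R := N%:R + d.
have e0 : 0 <= e by rewrite addr_ge0// ltW.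
pose q1 : R := 2 `^ (- d); pose q2 : R := 2 `^ (d - 2).
have pow_lt1 (a : R) : 0 < a -> 0 < (2 : R) `^ (- a) < 1.
  move=> a'; rewrite powR_gt0//= powRN invf_lt1 ?powR_gt0//.
  have /= := gt0_ltr_powR a' (_ : 1 \in Num.nneg) (_ : 2 \in Num.nneg).
  by rewrite powR1; apply; rewrite ?nnegrE ?ltr1n.
pose C : R := 4 ^+ N * 2 `^ d.
exists (C / (1 - q1) + C / (1 - q2)).
  have /andP[_ q11] := pow_lt1 _ d0.
  have q21 : q2 < 1.
    have := pow_lt1 (2 - d); rewrite subr_gt0 => /(_ d2) /andP[_].
    by rewrite opprB.
  by rewrite addr_gt0// divr_gt0 ?subr_gt0// mulr_gt0 ?powR_gt0// exprn_gt0.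
move=> r r0.
pose w t := Num.min (t ^+ 2) 1 / (r * t / 2) `^ e.
have w0 t : 0 <= w t.
  by rewrite divr_ge0 ?powR_ge0// le_min sqr_ge0 ler01.
pose t1 k : R := 2 ^+ k.+1; pose t2 k : R := (2 ^+ k)^-1.
pose G1 := cube_series (w \o t1) (fun k => r * t1 k).
pose G2 := cube_series (w \o t2) (fun k => r * t2 k).
have mG1 : measurable_fun setT G1.
  by apply: measurable_cube_series => k; exact: w0.
have mG2 : measurable_fun setT G2.
  by apply: measurable_cube_series => k; exact: w0.
have G10 y : (0 <= G1 y)%E by apply: cube_series_ge0 => k; exact: w0.
have G20 y : (0 <= G2 y)%E by apply: cube_series_ge0 => k; exact: w0.
exists (fun y => G1 y + G2 y)%E; split.
- exact: emeasurable_funD.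
- by move=> y; rewrite adde_ge0.
- move=> y y0; have [k shell] := dyadic_shell (enorm_gt0 y0) r0.
  case: shell => [|] kz.
  + apply: (@le_trans _ _ (w (t1 k))%:E).
      rewrite lee_fin; apply: shell_weight => //; first by rewrite exprn_gt0.
      by rewrite /t1 {1}exprS mulrCA mulrC mulKf//.
    have wk : ((w (t1 k))%:E <= G1 y)%E.
      apply: (@cube_series_ge (w \o t1)) => [i|]; first exact: w0.
      by apply: mem_cube; case/andP: kz.
    by apply: (le_trans wk); rewrite leeDl.
  + apply: (@le_trans _ _ (w (t2 k))%:E).
      rewrite lee_fin; apply: shell_weight => //.
        by rewrite invr_gt0 exprn_gt0.
      by rewrite /t2 -mulrA -invfM -exprSr.
    have wk : ((w (t2 k))%:E <= G2 y)%E.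
      apply: (@cube_series_ge (w \o t2)) => [i|]; first exact: w0.
      by apply: mem_cube; case/andP: kz.
    by apply: (le_trans wk); rewrite leeDr.
rewrite ge0_integralD// mulrDl EFinD; apply: leeD.
- rewrite mulrAC; apply: integral_cube_series_le => [k|k||k].
  + exact: w0.
  + by rewrite mulr_ge0 ?(ltW r0)// exprn_ge0.
  + exact: pow_lt1.
  + rewrite dyadic_weight ?exprn_gt0// ler_wpM2l//.
      by rewrite !mulr_ge0 ?powR_ge0.
    apply: (@le_trans _ _ (1 * t1 k `^ (- d))).
      by rewrite ler_wpM2r ?powR_ge0// ge_min lexx orbT.
    rewrite mul1r /t1 -powR_mulrn// -powRrM mulrC powRrM powR_mulrn ?powR_ge0//.
    have /andP[h0 h1] := pow_lt1 _ d0.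
    by rewrite exprS ger_pMl ?exprn_gt0// ltW.
- rewrite mulrAC; apply: integral_cube_series_le => [k|k||k].
  + exact: w0.
  + by rewrite mulr_ge0 ?(ltW r0)// invr_ge0 exprn_ge0.
  + by rewrite /q2 -[d - 2]opprK opprB; apply: pow_lt1; rewrite subr_gt0.
  + rewrite dyadic_weight ?invr_gt0 ?exprn_gt0// ler_wpM2l//.
      by rewrite !mulr_ge0 ?powR_ge0.
    apply: (@le_trans _ _ (t2 k ^+ 2 * t2 k `^ (- d))).
      by rewrite ler_wpM2r ?powR_ge0// ge_min lexx.
    have t2E : t2 k = 2 `^ (- k%:R) by rewrite /t2 -powR_mulrn// powRN.
    rewrite -powR_mulrn ?invr_ge0 ?exprn_ge0// -powRD; last first.
      by apply/implyP => _; rewrite gt_eqF// invr_gt0 exprn_gt0.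
    rewrite t2E -powRrM -[leRHS]powR_mulrn ?powR_ge0// -powRrM.
    by rewrite le_eqVlt; apply/orP; left; apply/eqP; congr (_ `^ _); ring.
Qed.

End kernel_bound.

(** * The fractional Laplacian at a touching point *)

Section frac_lap_theory.
Context {R : realType} {n : nat}.
Local Notation mu := (lebesgue_Rn R n).
Local Notation T := (caratheodory_type (@lebesgue_outer R n)).
Implicit Types (u v : 'rV[R]_n.+1 -> R) (x y : 'rV[R]_n.+1) (alpha c : R).

Lemma second_diff0 u x : second_diff u x 0 = 0.
Proof. by rewrite /second_diff addr0 subr0; ring. Qed.

Lemma frac_kernelB alpha u v c x y :
  frac_kernel alpha (fun z => u z - c * v z) x y =
  frac_kernel alpha u x y - c * frac_kernel alpha v x y.
Proof. by rewrite /frac_kernel /second_diff; ring. Qed.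

Lemma frac_lap_definedB alpha u v c x :
  frac_lap_defined alpha u x -> frac_lap_defined alpha v x ->
  frac_lap_defined alpha (fun z => u z - c * v z) x.
Proof.
move=> du dv; rewrite /frac_lap_defined.
have cdv := integrableZl measurableT c dv.
apply: eq_integrable (integrableB measurableT du cdv) => // y _ /=.
by rewrite frac_kernelB EFinB EFinM.
Qed.

Lemma frac_lapB alpha u v c x :
  frac_lap_defined alpha u x -> frac_lap_defined alpha v x ->
  frac_lap alpha (fun z => u z - c * v z) x =
  frac_lap alpha u x - c * frac_lap alpha v x.
Proof.
move=> du dv; rewrite /frac_lap.
under eq_Rintegral do rewrite frac_kernelB.
rewrite RintegralB//; last first.
  apply: eq_integrable (integrableZl measurableT c dv) => // y _.
by rewrite RintegralZl//; ring.
Qed.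

(** The hypothesis on second differences is one-sided because it comes from a
touching point: a bump of radius r provides it, with A twice its height. *)
Lemma frac_lap_ge alpha : 0 < alpha < 1 ->
  exists2 M : R, 0 < M & forall r A u x, 0 < r -> 0 <= A ->
    frac_lap_defined alpha u x ->
    {ae mu, forall y,
       second_diff u x y <= A * Num.min (enorm y ^+ 2 / r ^+ 2) 1} ->
    - (A * (M * r `^ (- (2 * alpha)))) <= frac_lap alpha u x.
Proof.
move=> a01; have [M M0 HM] := @bump_kernel_bound R n alpha a01.
exists M => // r A u x r0 A0 du duA.
have [G [mG G0 Gge IG]] := HM r r0.
set B := M * _ in IG *.
have B0 : 0 <= B by rewrite mulr_ge0 ?powR_ge0// ltW.
pose k : T -> \bar R := EFin \o frac_kernel alpha u x.
have ke : (\int[mu]_y k y <= (A * B)%:E)%E.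
  rewrite integralE; apply: (@le_trans _ _ (\int[mu]_y k^\+ y)%E).
    rewrite leeBlDr ?leeDl//; first exact: integral_ge0.
    exact: integrable_neg_fin_num.
  rewrite EFinM; apply: (@le_trans _ _ (\int[mu]_y (A%:E * G y))%E).
    apply: ae_ge0_le_integral => //.
    - exact: measurable_funepos (measurable_int _ du).
    - by move=> y _; rewrite mule_ge0 ?lee_fin.
    - exact: measurable_funeM.
    apply: ae_impl duA => y yA _.
    rewrite funeposE ge_max mule_ge0 ?lee_fin// andbT.
    have [->|y0] := eqVneq y 0.
      by rewrite /k/= /frac_kernel second_diff0 mul0r mule_ge0 ?lee_fin.
    have /le_trans -> // : (k y <= (A * (Num.min (enorm y ^+ 2 / r ^+ 2) 1 /
        enorm y `^ (n.+1%:R + 2 * alpha)))%:E)%E.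
      by rewrite lee_fin mulrA ler_wpM2r// invr_ge0 powR_ge0.
    by rewrite EFinM; apply: lee_wpmul2l; rewrite ?lee_fin//; exact: Gge.
  by rewrite ge0_integralZl ?lee_fin//; apply: lee_wpmul2l; rewrite ?lee_fin.
have kfin : (\int[mu]_y k y)%E \is a fin_num by exact: integrable_fin_num.
have {}ke : \int[mu]_y frac_kernel alpha u x y <= A * B.
  by rewrite /Rintegral -lee_fin fineK.
rewrite /frac_lap mulNr lerN2.
have AB0 : 0 <= A * B by rewrite mulr_ge0.
move: ke AB0; lra.
Qed.

(** The case of equality in the maximum principle: a nonnegative function with a
nonpositive integral vanishes. *)
Lemma second_diff_ae_eq0 alpha u x :
  frac_lap_defined alpha u x -> {ae mu, forall y, 0 <= second_diff u x y} ->
  0 <= frac_lap alpha u x -> {ae mu, forall y, second_diff u x y = 0}.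
Proof.
move=> du du0 lap0.
pose k : T -> \bar R := EFin \o frac_kernel alpha u x.
have mk : measurable_fun setT k := measurable_int _ du.
have kfin : (\int[mu]_y k y)%E \is a fin_num by exact: integrable_fin_num.
have k0 : (\int[mu]_y `|k y| = 0)%E.
  apply/eqP; rewrite eq_le integral_ge0// andbT.
  rewrite (ae_eq_integral k)//.
  - rewrite -(fineK kfin) lee_fin.
    by move: lap0; rewrite /frac_lap /Rintegral; lra.
  - exact: measurableT_comp.
  apply: ae_impl du0 => y y0 _; rewrite /k/= ger0_norm//.
  by rewrite mulr_ge0// invr_ge0 powR_ge0.
have := (ae_eq_integral_abs mu measurableT mk).1 k0.
apply: ae_impl => y /(_ I)/= [/eqP]; rewrite /frac_kernel.
have [-> _|y0] := eqVneq y 0; first exact: second_diff0.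
by rewrite mulf_eq0 invr_eq0 (gt_eqF (powR_gt0 _ (enorm_gt0 y0))) orbF => /eqP.
Qed.

End frac_lap_theory.

(** * The distance to the boundary *)

Section distance_to_boundary.
Context {R : realType} {n : nat}.
Implicit Types (x y z : 'rV[R]_n.+1) (Omega : set 'rV[R]_n.+1) (e : R).

Lemma enorm_nbhsP x (U : set 'rV[R]_n.+1) :
  nbhs x U <-> exists2 e, 0 < e & forall y, enorm (y - x) < e -> U y.
Proof.
split=> [/nbhs_ballP[e/= e0 eU]|[e e0 eU]].
  exists e => // y yx; apply: eU; rewrite mx_norm_ball /ball_/=.
  by rewrite distrC; exact: le_lt_trans (norm_le_enorm _) yx.
exact: filterS (enorm_ball_nbhs x e0).
Qed.

Lemma dist_bdry_le Omega x y :
  bdry Omega y -> dist_bdry Omega x <= enorm (x - y).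
Proof.
move=> By; apply: ge_inf; last by exists y.
by exists 0 => _ [z _ <-]; exact: enorm_ge0.
Qed.

Lemma dist_bdry_lipschitz Omega x z :
  dist_bdry Omega x <= dist_bdry Omega z + enorm (x - z).
Proof.
have [B0|/nonemptyPn B0] := pselect (bdry Omega !=set0); last first.
  by rewrite /dist_bdry B0 !image_set0 inf0 add0r enorm_ge0.
rewrite -lerBlDr; apply: lb_le_inf.
  by case: B0 => y By; exists (enorm (z - y)), y.
move=> _ [y By <-]; rewrite lerBlDr; apply: le_trans (dist_bdry_le x By) _.
by rewrite -{1}(subrK z x) -addrA addrC enormD.
Qed.

Lemma continuous_dist_bdry Omega : continuous (dist_bdry Omega).
Proof.
move=> x; apply/(@cvgrPdist_lt _ _ _ _ (nbhs_filter x)) => e e0.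
apply/enorm_nbhsP; exists e => // y yx.
apply: le_lt_trans yx; rewrite ler_norml lerNl opprB !lerBlDl.
by rewrite dist_bdry_lipschitz/= enorm_distC dist_bdry_lipschitz.
Qed.

Lemma closure_dist_gt0 Omega x :
  closure Omega x -> 0 < dist_bdry Omega x -> Omega x.
Proof.
move=> clx dx; apply: contrapT => nOx.
have /dist_bdry_le : bdry Omega x.
  by split=> // /interior_subset.
by move/(_ x); rewrite subrr enorm0 leNgt dx.
Qed.

(** The segment from x to a point outside Omega meets the boundary, at the
supremum of the times that it spends in Omega. *)
Lemma dist_bdry_ball Omega x z : open Omega -> Omega x ->
  enorm (z - x) < dist_bdry Omega x -> Omega z.
Proof.
move=> oO Ox zx; apply: contrapT => nOz.
pose p t := x + t *: (z - x).
have pB s t : enorm (p s - p t) = `|s - t| * enorm (z - x).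
  by rewrite /p opprD addrACA subrr add0r -scalerBl enormZ.
pose S := [set t : R | 0 <= t <= 1 /\ Omega (p t)].
have S0 : S 0 by split; rewrite ?lexx ?ler01// /p scale0r addr0.
have supS : has_sup S.
  by split; [exists 0|exists 1 => t [/andP[]]].
pose s := sup S.
have s0 : 0 <= s by apply: ub_le_sup => //; case: supS.
have s1 : s <= 1 by apply: ge_sup; [exists 0|move=> t [/andP[]]].
pose L := enorm (z - x) + 1.
have L0 : 0 < L by rewrite ltr_wpDl ?enorm_ge0.
have pBL t e : `|t - s| < e / L -> enorm (p t - p s) < e.
  move=> ts; rewrite pB (@le_lt_trans _ _ (`|t - s| * L))//.
    by rewrite ler_wpM2l// lerDl.
  by rewrite -ltr_pdivlMr.
have : bdry Omega (p s).
  split=> [U /enorm_nbhsP[e e0 eU]|/enorm_nbhsP[e e0 eO]].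
    have [|t St ts] := @sup_adherent _ S (e / L) _ supS.
      by rewrite divr_gt0.
    exists (p t); split; first by case: St.
    have ts' : t <= s by apply: ub_le_sup => //; case: supS.
    by apply/eU/pBL; rewrite ler0_norm ?subr_le0// opprB ltrBlDl -ltrBlDr.
  have [s1'|s1'] := eqVneq s 1.
    apply: nOz; have := eO (p s); rewrite subrr enorm0 => /(_ e0).
    by rewrite /p s1' scale1r addrC subrK.
  have slt1 : s < 1 by rewrite lt_neqAle s1' s1.
  pose t := Num.min 1 (s + e / L / 2).
  have h0 : 0 < e / L / 2 by rewrite !divr_gt0.
  have st : s < t by rewrite lt_min slt1 ltrDl.
  have St : S t.
    split; first by rewrite (le_trans s0 (ltW st)) ge_min lexx.
    apply/eO/pBL; rewrite ger0_norm ?subr_ge0 ?(ltW st)// ltrBlDl gt_min.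
    by apply/orP; right; rewrite ltrD2l; move: h0; lra.
  have : t <= s by apply: ub_le_sup => //; case: supS.
  by rewrite leNgt st.
move/(dist_bdry_le x); apply/negP; rewrite -ltNge (le_lt_trans _ zx)//.
have -> : x - p s = p 0 - p s by rewrite {2}/p scale0r addr0.
by rewrite pB add0r normrN ger0_norm// ler_piMl ?enorm_ge0.
Qed.

(** A point of the closure at positive distance from the boundary belongs to
Omega, so this set is closed. *)
Lemma compact_dist_ge Omega e : bounded_set Omega -> 0 < e ->
  compact [set x | Omega x /\ e <= dist_bdry Omega x].
Proof.
move=> bO e0; apply: bounded_closed_compact.
  case: bO => M [Mr OM]; exists M; split => // N MN x [Ox _]; exact: OM Ox.
have -> : [set x | Omega x /\ e <= dist_bdry Omega x] =
    closure Omega `&` (dist_bdry Omega @^-1` [set t | e <= t]).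
  apply/seteqP; split=> x [Ox dx]; split => //; first exact: subset_closure.
  by apply: closure_dist_gt0 => //; exact: lt_le_trans dx.
apply: closedI; first exact: closed_closure.
apply: closed_comp; last exact: closed_ge.
by move=> x _; exact: continuous_dist_bdry.
Qed.

Lemma exists_near_bdry Omega e : Omega !=set0 ->
  (forall x, Omega x -> 0 < dist_bdry Omega x) -> 0 < e ->
  exists2 x, Omega x & dist_bdry Omega x < e.
Proof.
move=> [x0 Ox0] d0 e0.
have [[y By]|/nonemptyPn B0] := pselect (bdry Omega !=set0); last first.
  by have := d0 _ Ox0; rewrite /dist_bdry B0 image_set0 inf0 ltxx.
have [|x [Ox xy]] := By.1 [set x | enorm (x - y) < e].
  exact: enorm_ball_nbhs.
by exists x => //; exact: le_lt_trans (dist_bdry_le x By) xy.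
Qed.

End distance_to_boundary.

(** * Touching a nonpositive function by a bump *)

Section touching_bump.
Context {R : realType} {n : nat}.
Local Notation mu := (lebesgue_Rn R n).
Implicit Types (x y z : 'rV[R]_n.+1) (Omega : set 'rV[R]_n.+1).

Lemma enorm_parallelogram x y :
  enorm (x + y) ^+ 2 + enorm (x - y) ^+ 2 = 2 * enorm x ^+ 2 + 2 * enorm y ^+ 2.
Proof.
rewrite !sqr_enorm !mulr_sumr -!big_split/=; apply: eq_bigr => i _.
by rewrite !mxE; ring.
Qed.

Lemma continuous_enorm : continuous (@enorm R n.+1).
Proof.
move=> x; apply/(@cvgrPdist_lt _ _ _ _ (nbhs_filter x)) => e e0.
apply/enorm_nbhsP; exists e => // y; apply: le_lt_trans.
by rewrite distrC enorm_lipschitz.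
Qed.

Lemma continuous_enorm_sub x : continuous (fun z => enorm (z - x)).
Proof.
move=> z; apply: (@continuous_comp _ _ _ (fun z => z - x) (@enorm R n.+1)).
  apply: (@continuousB _ _ _ id (cst x)); first exact: cvg_id.
  exact: cst_continuous.
exact: continuous_enorm.
Qed.

Lemma compact_enorm_ball x (r : R) : compact [set z | enorm (z - x) <= r].
Proof.
apply: bounded_closed_compact.
  exists (`|x| + r); split; first exact: num_real.
  move=> M xM z /= zx; rewrite -(subrK x z) (le_trans (ler_normD _ _))//.
  rewrite addrC (le_trans _ (ltW xM))// lerD2l.
  exact: le_trans (norm_le_enorm _) zx.
have -> : [set z | enorm (z - x) <= r] =
  (fun z => enorm (z - x)) @^-1` [set t | t <= r] by [].
apply: closed_comp; last exact: closed_le.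
by move=> z _; exact: continuous_enorm_sub.
Qed.

(** The point x is a maximum point of W = w + A q on the ball, where
q = 1 - |z - x0|^2 / r^2. As W x > 0, it is also a maximum point, up to a null
set, of w + A max(0, q) on the whole space. So the second differences of w at x
are at most those of - A max(0, q), which are bounded in two ways: by the
heights, as 0 <= max(0, q) and q x <= 1, and by the second differences of - A q,
since max(0, q) >= q with equality at x. *)
Lemma touching_bump Omega (w : 'rV[R]_n.+1 -> R) x0 (r A : R) :
  open Omega -> {within Omega, continuous w} ->
  (forall x, Omega x -> w x <= 0) ->
  {ae mu, forall x, ~ Omega x -> w x = 0} ->
  0 < r -> (forall x, enorm (x - x0) <= r -> Omega x) ->
  0 < A -> - A < w x0 ->
  exists x, [/\ enorm (x - x0) <= r, - A <= w x &
    {ae mu, forall y,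
      second_diff w x y <= 2 * A * Num.min (enorm y ^+ 2 / r ^+ 2) 1}].
Proof.
move=> oO cw w0 wae r0 BO A0 Aw.
pose q z := 1 - enorm (z - x0) ^+ 2 / r ^+ 2.
pose W z := w z + A * q z.
pose B := [set z | enorm (z - x0) <= r].
have r2 : 0 < r ^+ 2 by rewrite exprn_gt0.
have Bx0 : B x0 by rewrite /B/= subrr enorm0 ltW.
have cW : {within B, continuous W}.
  apply: continuous_in_subspaceT => z /set_mem Bz.
  apply: (@continuousD _ _ _ w (fun z => A * q z)).
    move: cw; rewrite continuous_open_subspace// => cw.
    by apply: cw; apply/mem_set; exact: BO.
  apply: (@continuousM R _ (cst A) q); first exact: cst_continuous.
  apply: (@continuousB R R _ (cst 1)); first exact: cst_continuous.
  apply: (@continuousM R _ (fun z => enorm (z - x0) ^+ 2) (cst _)).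
    apply: (@continuous_comp _ _ _ (fun z => enorm (z - x0)) (fun t => t ^+ 2)).
      exact: continuous_enorm_sub.
    exact: exprn_continuous.
  exact: cst_continuous.
have [x /set_mem Bx Wx] :=
  compact_EVT_max (ex_intro _ x0 Bx0) (@compact_enorm_ball x0 r) cW.
have Wx0 : 0 < W x.
  apply: lt_le_trans (Wx x0 (mem_set Bx0)).
  rewrite /W /q subrr enorm0 expr0n/= mul0r subr0 mulr1; move: Aw; lra.
have q1 z : q z <= 1 by rewrite /q gerBl divr_ge0// sqr_ge0.
have wx0 : w x <= 0 by apply: w0; exact: BO.
exists x; split => //.
  have := ler_wpM2l (ltW A0) (q1 x); move: Wx0; rewrite /W; lra.
pose P z := w z + A * Num.max 0 (q z) <= W x.
have Pae : {ae mu, forall z, P z}.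
  apply: ae_impl wae => z zO; rewrite /P.
  have [Bz|] := lerP (enorm (z - x0)) r.
    have qz : 0 <= q z.
      rewrite /q subr_ge0 ler_pdivrMr// mul1r.
      by rewrite ler_sqr ?nnegrE ?enorm_ge0 ?(ltW r0).
    by rewrite max_r//; apply: Wx; exact: mem_set.
  move=> rz; have qz : q z <= 0.
    rewrite /q subr_le0 ler_pdivlMr// mul1r.
    by rewrite ler_sqr ?nnegrE ?enorm_ge0 ?(ltW r0) ?(ltW rz).
  rewrite max_l// mulr0 addr0; apply: le_trans (ltW Wx0).
  by have [/w0|/zO ->] := pselect (Omega z).
apply: ae_impl (ae_and (ae_shift x Pae) (ae_reflect x Pae)) => y [].
rewrite /P /second_diff => hp hm.
have qpm : q (x + y) + q (x - y) = 2 * q x - 2 * (enorm y ^+ 2 / r ^+ 2).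
  rewrite /q [x + y - x0]addrAC [x - y - x0]addrAC.
  have := enorm_parallelogram (x - x0) y; move: (enorm _) (enorm _) => a b.
  move=> /(congr1 (fun t => t / r ^+ 2)); rewrite !mulrDl.
  set X := a ^+ 2 / _; set Y := b ^+ 2 / _; rewrite -!mulrA => h; lra.
have m0p : 0 <= Num.max 0 (q (x + y)) by rewrite le_max lexx.
have mqp : q (x + y) <= Num.max 0 (q (x + y)) by rewrite le_max lexx orbT.
have m0m : 0 <= Num.max 0 (q (x - y)) by rewrite le_max lexx.
have mqm : q (x - y) <= Num.max 0 (q (x - y)) by rewrite le_max lexx orbT.
apply: (@le_trans _ _
    (A * (2 * q x - Num.max 0 (q (x + y)) - Num.max 0 (q (x - y))))).
  by move: hp hm; rewrite /W; lra.
rewrite [2 * A]mulrC -mulrA ler_pM2l// minr_pMr// mulr1 le_min.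
apply/andP; split.
  by move: qpm mqp mqm; lra.
by have := q1 x; move: m0p m0m; lra.
Qed.

End touching_bump.

(** * Large solutions *)

Section large_solutions.
Context {R : realType} {n : nat}.
Local Notation mu := (lebesgue_Rn R n).
Variables (Omega : set 'rV[R]_n.+1) (alpha p : R).
Hypothesis Omega_neq0 : Omega !=set0.
Hypothesis Omega_open : open Omega.
Hypothesis Omega_bounded : bounded_set Omega.
Hypothesis Omega_C2 : C2_domain Omega.
Hypothesis alpha01 : 0 < alpha < 1.
Hypothesis p_gt1 : 1 < p.
Local Notation d := (dist_bdry Omega).
Implicit Types (x y z : 'rV[R]_n.+1) (f g u v : 'rV[R]_n.+1 -> R) (s : R).

Lemma exact_rateP g s : exact_rate Omega g s ->
  exists c C e, [/\ 0 < c, 0 < e &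
    forall x, Omega x -> d x < e -> c <= g x * d x `^ s <= C].
Proof.
move=> [+ _ +]; rewrite limf_einfE limf_esupE.
move=> /ereal_sup_gt[_ [V [e1 /= e10 Ve] <-] V0].
move=> /ereal_inf_lt[_ [W [e2 /= e20 We] <-] Woo].
have [c [c0 Vc]] : exists c, 0 < c /\ forall x, V x -> c <= g x * d x `^ s.
  have lbV x : V x -> (ereal_inf [set (g y * d y `^ s)%:E | y in V] <=
      (g x * d x `^ s)%:E)%E by move=> Vx; apply: ereal_inf_lbound; exists x.
  move: V0 lbV; case: (ereal_inf _) => [m| |]//=; rewrite ?lte_fin => m0 lbV.
    by exists m; split => // x /lbV; rewrite lee_fin.
  by exists 1; split => // x /lbV; rewrite leye_eq.
have [C WC] : exists C, forall x, W x -> g x * d x `^ s <= C.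
  have ubW x : W x -> ((g x * d x `^ s)%:E <=
      ereal_sup [set (g y * d y `^ s)%:E | y in W])%E.
    by move=> Wx; apply: ereal_sup_ubound; exists x.
  move: Woo ubW; case: (ereal_sup _) => [m| |]//= _ ubW.
    by exists m => x /ubW; rewrite lee_fin.
  by exists 0 => x /ubW; rewrite leeNy_eq.
exists c, C, (Num.min e1 e2); split => //; first by rewrite lt_min e10.
move=> x Ox; rewrite lt_min => /andP[d1 d2].
by rewrite Vc ?WC//; [exact: We|exact: Ve].
Qed.

Lemma dist_bdry_ge0 x : 0 <= d x.
Proof.
have [[y By]|/nonemptyPn B0] := pselect (bdry Omega !=set0); last first.
  by rewrite /dist_bdry B0 image_set0 inf0.
apply: lb_le_inf; first by exists (enorm (x - y)), y.
by move=> _ [z _ <-]; exact: enorm_ge0.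
Qed.

Section one_solution.
Variables (f u : 'rV[R]_n.+1 -> R).
Hypothesis solu : solution alpha p Omega f u.

Lemma solution_blowup (M : R) :
  exists2 e : R, 0 < e & forall x, Omega x -> d x < e -> M <= u x.
Proof.
have [_ _ _ _ uoo] := solu.
have [|e /= e0 eM] := uoo [set t | M <= t].
  by exists M; split; [exact: num_real|move=> t /ltW].
by exists e => // x Ox dx; exact: (eM x (conj Ox dx)).
Qed.

(** Blow-up at the boundary excludes d x = 0, as u x would be at least u x + 1.
This covers the case of an empty boundary, where d is 0 by convention. *)
Lemma dist_bdry_gt0 x : Omega x -> 0 < d x.
Proof.
move=> Ox; rewrite lt_neqAle dist_bdry_ge0 andbT; apply/eqP => d0.
have [e e0 /(_ x Ox)] := solution_blowup (u x + 1).
by rewrite -d0 => /(_ e0); rewrite gerDl ler10.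
Qed.

Lemma solution_ae0 : {ae mu, forall z, ~ Omega z -> u z = 0}.
Proof.
have [_ _ _ u0 _] := solu.
have nB : {ae mu, forall z, ~ bdry Omega z}.
  apply: negligibleS (bdry_negligible Omega_C2) => z /=.
  exact: contrapT.
apply: ae_impl (ae_and u0 nB) => z [uz Bz] Oz; apply: uz => clz; apply: Bz.
by split => // /interior_subset.
Qed.

Lemma solution_continuousW (e : R) :
  {within [set x | Omega x /\ e <= d x], continuous u}.
Proof.
by have [cu _ _ _ _] := solu; apply: continuous_subspaceW cu => x [].
Qed.

Hypothesis f_ge0 : forall x, Omega x -> 0 <= f x.

(** The minimum point m is global up to a null set: u >= 1 near the boundary and
u = 0 almost everywhere outside Omega. *)
Lemma solution_gt0 x : Omega x -> 0 < u x.
Proof.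
move=> Ox; rewrite ltNge; apply/negP => ux0.
have [e e0 u1] := solution_blowup 1.
pose K := [set x | Omega x /\ e <= d x].
have Kx : K x.
  split => //; rewrite leNgt; apply/negP => /(u1 x Ox).
  by rewrite leNgt (le_lt_trans ux0).
have [m /set_mem[Om dm] um] := compact_EVT_min (ex_intro _ x Kx)
  (compact_dist_ge Omega_bounded e0) (@solution_continuousW e).
have um0 : u m <= 0 by apply: le_trans (um x (mem_set Kx)) ux0.
have Pae : {ae mu, forall z, u m <= u z}.
  apply: ae_impl solution_ae0 => z uz.
  have [Oz|/uz ->//] := pselect (Omega z).
  have [/(u1 z Oz)/(le_trans _)|dz] := ltP (d z) e.
    by apply; rewrite (le_trans um0).
  by apply: um; exact: mem_set.
have [_ _ eqm _ _] := solu; have [defm eqmm] := eqm m Om.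
have sd : {ae mu, forall y, second_diff u m y = 0}.
  apply: second_diff_ae_eq0 defm _ _.
    apply: ae_impl (ae_and (ae_shift m Pae) (ae_reflect m Pae)) => y [h1 h2].
    by rewrite /second_diff; lra.
  have := f_ge0 Om; rewrite -eqmm.
  have : `|u m| `^ (p - 1) * u m <= 0 by rewrite mulr_ge0_le0 ?powR_ge0.
  lra.
have um_ae : {ae mu, forall y, u (m + y) = u m}.
  apply: ae_impl (ae_and sd (ae_and (ae_shift m Pae) (ae_reflect m Pae))).
  by move=> y [+ [h1 h2]]; rewrite /second_diff; lra.
have {}um_ae : {ae mu, forall y, u y = u m}.
  by apply: ae_impl (ae_shift (- m) um_ae) => y; rewrite addrA subrr add0r.
pose V := [set x | Omega x /\ d x < e].
have oV : open V.
  have -> : V = Omega `&` (d @^-1` [set t | t < e]) by [].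
  apply: openI => //; apply: open_comp; last exact: open_lt.
  by move=> y _; exact: continuous_dist_bdry.
have V0 : V = set0.
  apply: negligible_open_eq0 => //.
  apply: negligibleS um_ae => z [Oz dz] /= uzm.
  by have := u1 z Oz dz; rewrite uzm leNgt (le_lt_trans um0).
have [y Oy dy] := exists_near_bdry Omega_neq0 dist_bdry_gt0 e0.
by have : V y by []; rewrite V0.
Qed.

Lemma solution_min_gt0 : exists2 m : R, 0 < m & forall x, Omega x -> m <= u x.
Proof.
have [e e0 u1] := solution_blowup 1.
pose K := [set x | Omega x /\ e <= d x].
have [K0|nK] := pselect (K !=set0).
  have [m /set_mem[Om dm] um] := compact_EVT_min K0
    (compact_dist_ge Omega_bounded e0) (@solution_continuousW e).
  exists (Num.min 1 (u m)); first by rewrite lt_min ltr01 solution_gt0.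
  move=> x Ox; rewrite ge_min; have [/(u1 x Ox) -> //|dx] := ltP (d x) e.
  by apply/orP; right; apply: um; exact: mem_set.
exists 1 => // x Ox; apply: u1 => //; rewrite ltNge; apply/negP => dx.
by apply: nK; exists x.
Qed.

Lemma solution_rate s : 0 < s -> exact_rate Omega u s ->
  exists c C : R, [/\ 0 < c, 0 < C &
    forall x, Omega x -> c <= u x * d x `^ s <= C].
Proof.
move=> s0 /exact_rateP[c [C [e [c0 e0 ce]]]].
have [m m0 um] := solution_min_gt0.
pose K := [set x | Omega x /\ e <= d x].
have [C' C'K] : exists C' : R, forall x, K x -> u x * d x `^ s <= C'.
  have [K0|nK] := pselect (K !=set0); last first.
    by exists 0 => x Kx; exfalso; apply: nK; exists x.
  have cK := compact_dist_ge Omega_bounded e0.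
  have [a /set_mem[Oa _] ua] := compact_EVT_max K0 cK (@solution_continuousW e).
  have [b _ db] := compact_EVT_max K0 cK
    (continuous_subspaceT (@continuous_dist_bdry R n Omega)).
  exists (u a * d b `^ s) => x Kx; apply: ler_pM.
  - by rewrite ltW// solution_gt0//; case: Kx.
  - exact: powR_ge0.
  - exact/ua/mem_set.
  - apply: ge0_ler_powR; rewrite ?nnegrE ?dist_bdry_ge0 ?(ltW s0)//.
    exact/db/mem_set.
exists (Num.min c (m * e `^ s)), (Num.max 1 (Num.max C C')); split.
- by rewrite lt_min c0 mulr_gt0// powR_gt0.
- by rewrite lt_max ltr01.
move=> x Ox; rewrite ge_min !le_max; have [dx|dx] := ltP (d x) e.
  by have /andP[-> ->] := ce x Ox dx; rewrite !orbT.
rewrite C'K// !orbT andbT; apply/orP; right; apply: ler_pM => //.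
- exact: ltW.
- exact: powR_ge0.
- exact: um.
- by apply: ge0_ler_powR; rewrite ?nnegrE ?dist_bdry_ge0 ?(ltW s0) ?(ltW e0).
Qed.

End one_solution.

(** As k < k^p, the inequality k < k1^p still holds for k1 slightly smaller than
k; k1 = k^((1 + 1/p) / 2) will do. *)
Lemma absorption_gap (k : R) : 1 < k ->
  exists k1, [/\ 0 < k1, k1 < k & k < k1 `^ (p - 1) * k1].
Proof.
move=> k1; have k0 : 0 < k by rewrite (lt_trans ltr01).
have powk (a b : R) : a < b -> k `^ a < k `^ b.
  move=> ab; rewrite -[b](subrK a) powRD; last first.
    by apply/implyP => _; rewrite gt_eqF.
  rewrite ltr_pMl ?powR_gt0//.
  have ba0 : 0 < b - a by rewrite subr_gt0.
  have /= := gt0_ltr_powR ba0 (_ : 1 \in Num.nneg) (_ : k \in Num.nneg).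
  by rewrite powR1; apply; rewrite ?nnegrE ?(ltW k0).
have p0 : 0 < p by rewrite (lt_trans ltr01).
have pV : p^-1 < 1 by rewrite invf_lt1.
exists (k `^ ((1 + p^-1) / 2)); split; first exact: powR_gt0.
  by rewrite -[ltRHS]powRr1 ?(ltW k0)//; apply: powk; lra.
rewrite mulrC mulr_powRB1 ?powR_ge0// -powRrM -[ltLHS]powRr1 ?(ltW k0)//.
have -> : (1 + p^-1) / 2 * p = (p + 1) / 2 by field; rewrite gt_eqF.
apply: powk.
by move: p_gt1; lra.
Qed.

Section two_solutions.
Variables (f u v : 'rV[R]_n.+1 -> R) (s : R).
Hypothesis f_ge0 : forall x, Omega x -> 0 <= f x.
Hypothesis s_gt0 : 0 < s.
Hypothesis f_rate : exists c e : R, [/\ 0 < c, 0 < e &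
  forall x, Omega x -> d x < e -> c <= f x * d x `^ (s + 2 * alpha)].
Hypothesis solu : solution alpha p Omega f u.
Hypothesis solv : solution alpha p Omega f v.
Hypothesis rateu : exact_rate Omega u s.
Hypothesis ratev : exact_rate Omega v s.

Let S0 : 0 < s + 2 * alpha.
Proof. by case/andP: alpha01 => a0 _; rewrite addr_gt0// mulr_gt0. Qed.

(** Near the boundary the source dominates; elsewhere f may vanish, but v is
bounded below by a positive constant. *)
Lemma source_lower_bound (a b : R) : 0 < a -> 0 < b ->
  exists2 c, 0 < c & forall x, Omega x ->
    c <= (a * f x + b * (v x `^ (p - 1) * v x)) * d x `^ (s + 2 * alpha).
Proof.
move=> a0 b0; have [c [e [c0 e0 fc]]] := f_rate.
have [m m0 vm] := solution_min_gt0 solv f_ge0.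
have mp0 : 0 < m `^ (p - 1) * m by rewrite mulr_gt0 ?powR_gt0.
have vp x : Omega x -> m `^ (p - 1) * m <= v x `^ (p - 1) * v x.
  move=> /vm mv; apply: ler_pM; rewrite ?powR_ge0 ?(ltW m0)//.
  have v0 : 0 <= v x by rewrite (le_trans (ltW m0)).
  by apply: ge0_ler_powR; rewrite ?nnegrE ?(ltW m0)// subr_ge0 ltW.
exists (Num.min (a * c) (b * (m `^ (p - 1) * m) * e `^ (s + 2 * alpha))).
  by rewrite lt_min !mulr_gt0 ?powR_gt0.
move=> x Ox; rewrite ge_min mulrDl; have [dx|dx] := ltP (d x) e.
  apply/orP; left; rewrite -[leLHS]addr0; apply: lerD.
    by rewrite -mulrA ler_pM2l// fc.
  rewrite mulr_ge0 ?powR_ge0// mulr_ge0 ?(ltW b0)//.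
  by rewrite (le_trans _ (vp x Ox))// ltW.
apply/orP; right; rewrite -[leLHS]add0r; apply: lerD.
  by rewrite !mulr_ge0 ?powR_ge0 ?(ltW a0) ?f_ge0.
apply: ler_pM; rewrite ?powR_ge0//.
- by rewrite mulr_ge0 ?(ltW b0) ?(ltW mp0).
- by rewrite ler_pM2l// vp.
- by apply: ge0_ler_powR; rewrite ?nnegrE ?dist_bdry_ge0 ?(ltW S0) ?(ltW e0).
Qed.

(** The difference of the equations of u and k v; the assumption k1 v <= u turns
the absorption terms into a multiple of v^p with the right sign. *)
Lemma frac_lap_diff_le (k k1 : R) x : Omega x -> 1 < k -> 0 < k1 ->
  k1 * v x <= u x ->
  frac_lap alpha (fun z => u z - k * v z) x <=
  - ((k - 1) * f x + (k1 `^ (p - 1) * k1 - k) * (v x `^ (p - 1) * v x)).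
Proof.
move=> Ox k_gt1 k10 uv.
have [_ _ /(_ x Ox)[du eu] _ _] := solu.
have [_ _ /(_ x Ox)[dv ev] _ _] := solv.
have u0 := solution_gt0 solu f_ge0 Ox; have v0 := solution_gt0 solv f_ge0 Ox.
rewrite frac_lapB//.
move: eu ev; rewrite !gtr0_norm// => eu ev.
have up : k1 `^ (p - 1) * k1 * (v x `^ (p - 1) * v x) <= u x `^ (p - 1) * u x.
  rewrite mulrACA -powRM ?(ltW k10) ?(ltW v0)//.
  have kv : 0 < k1 * v x by rewrite mulr_gt0.
  apply: ler_pM => //; rewrite ?powR_ge0 ?(ltW kv)//.
  by apply: ge0_ler_powR; rewrite ?nnegrE ?(ltW kv) ?(ltW u0)// subr_ge0 ltW.
move: eu ev up; set fu := frac_lap _ u x; set fv := frac_lap _ v x.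
set U := u x `^ _ * _; set V := v x `^ _ * _ => eu ev up.
have -> : fu = f x - U by lra.
have -> : fv = f x - V by lra.
move: up; lra.
Qed.

(** The bump has radius d(x0) / 2 and height e d(x0)^-s. Smallness of e serves
twice: e <= E1 contradicts the lower bound of [frac_lap_ge], and e <= E2 ensures
k1 v <= u at the maximum point, which is what [frac_lap_diff_le] asks for. *)
Lemma solution_diff_le (k : R) : 1 < k ->
  (forall x, Omega x -> u x <= k * v x) ->
  exists2 e : R, 0 < e & forall x, Omega x ->
    u x - k * v x <= - (e * d x `^ (- s)).
Proof.
move=> k_gt1 ukv; have [a0 a1] := andP alpha01.
have [k1 [k10 k1k kgap]] := absorption_gap k_gt1.
have [c [C [c0 C0 vc]]] := solution_rate solv f_ge0 s_gt0 ratev.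
have [b b0 fb] : exists2 b, 0 < b & forall x, Omega x -> b <=
    ((k - 1) * f x + (k1 `^ (p - 1) * k1 - k) * (v x `^ (p - 1) * v x)) *
    d x `^ (s + 2 * alpha).
  by apply: source_lower_bound; rewrite subr_gt0.
have [M M0 lapM] := @frac_lap_ge R n alpha alpha01.
pose E1 := b * 2 `^ (- (s + 2 * alpha)) / (4 * M * 2 `^ (2 * alpha)).
pose E2 := (k - k1) * c * 2 `^ (- s).
have E10 : 0 < E1 by rewrite divr_gt0 ?mulr_gt0 ?powR_gt0.
have E20 : 0 < E2 by rewrite !mulr_gt0 ?powR_gt0// subr_gt0.
pose e := Num.min E1 E2; have e0 : 0 < e by rewrite lt_min E10.
exists e => // x0 Ox0; set rho := d x0.
have rho0 : 0 < rho := dist_bdry_gt0 solu Ox0.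
have rho20 : 0 < 2 * rho by rewrite mulr_gt0.
rewrite leNgt; apply/negP => Aw; set A := e * _ in Aw.
have A0 : 0 < A by rewrite mulr_gt0 ?powR_gt0.
pose w z := u z - k * v z.
have cw : {within Omega, continuous w}.
  have [+ _ _ _ _] := solu; have [+ _ _ _ _] := solv.
  rewrite !continuous_open_subspace// => cv cu x Ox.
  apply: (@continuousB R R _ u (fun z => k * v z)); first exact: cu.
  by apply: (@continuousM R _ (cst k) v); [exact: cst_continuous|exact: cv].
have w0 x : Omega x -> w x <= 0 by move=> Ox; rewrite subr_le0 ukv.
have wae : {ae mu, forall z, ~ Omega z -> w z = 0}.
  apply: ae_impl (ae_and (solution_ae0 solu) (solution_ae0 solv)).
  by move=> z [uz vz] Oz; rewrite /w uz// vz// mulr0 subr0.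
have r0 : 0 < rho / 2 by rewrite divr_gt0.
have BO x : enorm (x - x0) <= rho / 2 -> Omega x.
  move=> xr; apply: (dist_bdry_ball Omega_open Ox0); apply: (le_lt_trans xr).
  by rewrite -/rho; move: rho0; lra.
have [x [xr wA sd]] := touching_bump Omega_open cw w0 wae r0 BO A0 Aw.
have Ox := BO x xr; have dx0 := dist_bdry_gt0 solu Ox.
have dx : d x <= 2 * rho.
  have := dist_bdry_lipschitz Omega x x0; rewrite -/rho; move: xr rho0; lra.
(* bounds by powers of d x become bounds by powers of rho, as d x <= 2 rho *)
have powM (q t h : R) : 0 < t -> 0 < h -> h <= q * d x `^ t ->
    h * 2 `^ (- t) * rho `^ (- t) <= q.
  move=> t0 h0 hq; rewrite -mulrA -powRM ?(ltW rho0)// powRN.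
  rewrite ler_pdivrMr ?powR_gt0//.
  apply: (le_trans hq); rewrite ler_wpM2l//.
    by have := lt_le_trans h0 hq; rewrite pmulr_lgt0 ?powR_gt0// => /ltW.
  by apply: ge0_ler_powR; rewrite ?nnegrE ?(ltW t0) ?(ltW dx0) ?(ltW rho20).
have uv : k1 * v x <= u x.
  have /andP[/(powM _ _ _ s_gt0 c0) hv _] := vc x Ox.
  have : A <= (k - k1) * v x.
    apply: (@le_trans _ _ (E2 * rho `^ (- s))).
      by rewrite ler_wpM2r ?powR_ge0// ge_min lexx orbT.
    by rewrite /E2 -!mulrA ler_pM2l ?subr_gt0// !mulrA.
  by move: wA; rewrite /w; lra.
have [_ _ /(_ x Ox)[du _] _ _] := solu.
have [_ _ /(_ x Ox)[dv _] _ _] := solv.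
have lap1 := frac_lap_diff_le Ox k_gt1 k10 uv.
have hX := powM _ _ _ S0 b0 (fb x Ox).
have A20 : 0 <= 2 * A by rewrite mulr_ge0// ltW.
have lap2 := lapM _ _ _ _ r0 A20 (frac_lap_definedB k du dv) sd.
have := le_trans lap2 lap1; rewrite lerN2 => /(le_trans hX).
apply/negP; rewrite -ltNge.
have -> : (rho / 2) `^ (- (2 * alpha)) =
    rho `^ (- (2 * alpha)) * 2 `^ (2 * alpha).
  rewrite powRM ?invr_ge0 ?(ltW rho0)//; congr (_ * _).
  by rewrite -powR_inv1// -powRrM mulN1r opprK.
have -> : rho `^ (- (s + 2 * alpha)) = rho `^ (- s) * rho `^ (- (2 * alpha)).
  by rewrite opprD powRD//; apply/implyP => _; rewrite gt_eqF.
have Z0 : 0 < rho `^ (- s) * rho `^ (- (2 * alpha)).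
  by rewrite mulr_gt0 ?powR_gt0.
rewrite [ltLHS](_ : _ = (2 * M * 2 `^ (2 * alpha) * e) *
  (rho `^ (- s) * rho `^ (- (2 * alpha)))); last by rewrite /A; ring.
rewrite ltr_pM2r// (@le_lt_trans _ _ (2 * M * 2 `^ (2 * alpha) * E1))//.
  by rewrite ler_pM2l ?mulr_gt0 ?powR_gt0// ge_min lexx.
have -> : 2 * M * 2 `^ (2 * alpha) * E1 = b * 2 `^ (- (s + 2 * alpha)) / 2.
  by rewrite /E1; field; rewrite !gt_eqF ?powR_gt0.
have : 0 < b * 2 `^ (- (s + 2 * alpha)) by rewrite mulr_gt0 ?powR_gt0.
move: (b * _) => t; lra.
Qed.

(** The supremum k of u / v cannot exceed 1, since by [solution_diff_le] a
larger k could be decreased by e / C2. *)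
Lemma solution_le x : Omega x -> u x <= v x.
Proof.
move=> Ox; rewrite leNgt; apply/negP => vu.
have u0 y : Omega y -> 0 < u y by exact: solution_gt0 solu f_ge0 _.
have v0 y : Omega y -> 0 < v y by exact: solution_gt0 solv f_ge0 _.
have [c1 [C1 [_ _ uC]]] := solution_rate solu f_ge0 s_gt0 rateu.
have [c2 [C2 [c20 C20 vc]]] := solution_rate solv f_ge0 s_gt0 ratev.
pose Q := [set u y / v y | y in Omega].
have hQ : has_sup Q.
  split; first by exists (u x / v x), x.
  exists (C1 / c2) => _ [y Oy <-]; have dy := dist_bdry_gt0 solu Oy.
  have /andP[_ uy] := uC y Oy; have /andP[vy _] := vc y Oy.
  have ds : 0 < d y `^ s by rewrite powR_gt0.
  have -> : u y / v y = (u y * d y `^ s) / (v y * d y `^ s).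
    by field; rewrite !gt_eqF// v0.
  have uy0 := u0 y Oy; have vy0 := v0 y Oy.
  apply: ler_pM => //; first by rewrite mulr_ge0// ltW.
    by rewrite invr_ge0 mulr_ge0// ltW.
  by rewrite lef_pV2 ?posrE// mulr_gt0.
pose k := sup Q.
have uk y : Omega y -> u y / v y <= k.
  by move=> Oy; apply: ub_le_sup; [case: hQ|exists y].
have k_gt1 : 1 < k.
  by apply: lt_le_trans (uk x Ox); rewrite ltr_pdivlMr ?v0// mul1r.
have [|e e0 wd] := solution_diff_le k_gt1.
  by move=> y Oy; rewrite -ler_pdivrMr ?v0// uk.
have : k <= k - e / C2.
  apply: ge_sup; first by case: hQ.
  move=> _ [y Oy <-]; rewrite ler_pdivrMr ?v0// mulrBl.
  have dy := dist_bdry_gt0 solu Oy.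
  have : e * (v y / C2) <= e * d y `^ (- s).
    rewrite ler_pM2l//; have /andP[_ vy] := vc y Oy.
    by rewrite powRN ler_pdivrMr// mulrC ler_pdivlMr ?powR_gt0.
  have := wd y Oy; rewrite (_ : e / C2 * v y = e * (v y / C2)); last by ring.
  move: (e * _) (e * _) => a b; lra.
by rewrite lerBrDr gerDl leNgt divr_gt0.
Qed.

End two_solutions.

Lemma positive_unique_of_source f s :
  (forall x, Omega x -> 0 <= f x) -> 0 < s ->
  (exists c e : R, [/\ 0 < c, 0 < e &
    forall x, Omega x -> d x < e -> c <= f x * d x `^ (s + 2 * alpha)]) ->
  positive_unique_solution alpha p Omega f s.
Proof.
move=> f0 s0 frate; split => [u [solu _] x|u v [solu rateu] [solv ratev]].
  exact: solution_gt0 solu f0 _.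
have uv x : Omega x -> u x = v x.
  move=> Ox; apply/eqP; rewrite eq_le.
  rewrite (solution_le f0 s0 frate solu solv)//.
  exact: (solution_le f0 s0 frate solv solu).
split => //.
apply: ae_impl (ae_and (solution_ae0 solu) (solution_ae0 solv)) => x [ux vx] _.
by have [/uv//|nOx] := pselect (Omega x); rewrite ux// vx.
Qed.

End large_solutions.

(* The dimension is N = n.+2. *)
Theorem theorem1p3 (R : realType) (n : nat) (Omega : set 'rV[R]_n.+2)
    (alpha tau0 beta p : R) (f : 'rV[R]_n.+2 -> R)
    (Omega_neq0 : Omega !=set0) (Omega_open : open Omega)
    (Omega_bounded : bounded_set Omega) (Omega_connected : connected Omega)
    (Omega_C2 : C2_domain Omega)
    (alpha01 : 0 < alpha < 1) (tau0P : is_tau0 alpha tau0)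
    (beta_gt0 : 0 < beta) (f_hoelder : C_loc beta Omega f)
    (f_ge0 : forall x, Omega x -> 0 <= f x)
    (p_gt1 : 1 < p) :
  (1 - 2 * alpha / tau0 <= p ->
   forall gamma : R, -1 - 2 * alpha < gamma < 0 ->
   exact_rate Omega f (- gamma) ->
   - 2 * alpha - 2 * alpha / (p - 1) <= gamma < - 2 * alpha ->
   positive_unique_solution alpha p Omega f (- gamma - 2 * alpha))
  /\
  (1 + 2 * alpha < p ->
   forall gamma : R, -1 - 2 * alpha < gamma < 0 ->
   exact_rate Omega f (- gamma) ->
   -1 - 2 * alpha < gamma < - 2 * alpha - 2 * alpha / (p - 1) ->
   positive_unique_solution alpha p Omega f (- (gamma / p))).
Proof.
have [a0 _] := andP alpha01; have p0 : 0 < p by rewrite (lt_trans ltr01).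
have pos_uniq := positive_unique_of_source Omega_neq0 Omega_open
  Omega_bounded Omega_C2 alpha01 p_gt1 f_ge0.
split=> [_ gamma _ /exact_rateP[c [C [e [c0 e0 fc]]]] /andP[_ ga]|].
  apply: pos_uniq; first by move: ga; lra.
  exists c, e; split => // x Ox dx.
  by rewrite subrK; case/andP: (fc x Ox dx).
move=> _ gamma /andP[_ g0] /exact_rateP[c [C [e [c0 e0 fc]]]] /andP[_ ga].
have gp0 : 0 < - (gamma / p) by rewrite -mulNr divr_gt0// oppr_gt0.
apply: pos_uniq => //.
(* near the boundary d <= 1, so this comparison of exponents is all that the
   lower bound on f requires *)
have exponent_le : - (gamma / p) + 2 * alpha <= - gamma.
  have p10 : 0 < p - 1 by rewrite subr_gt0.
  have : 2 * alpha / (p - 1) <= - (gamma / p).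
    rewrite -mulNr ler_pdivlMr//.
    have -> : 2 * alpha / (p - 1) * p = 2 * alpha + 2 * alpha / (p - 1).
      by field; rewrite gt_eqF.
    by move: ga; lra.
  rewrite ler_pdivrMr// => h.
  have -> : - gamma = - (gamma / p) * p by field; rewrite gt_eqF.
  by move: h; lra.
exists c, (Num.min 1 e); split => //; first by rewrite lt_min ltr01.
move=> x Ox; rewrite lt_min => /andP[d1 dx].
have /andP[/le_trans fx _] := fc x Ox dx; apply: fx.
rewrite ler_wpM2l ?f_ge0//.
have [->|dx0] := eqVneq (dist_bdry Omega x) 0.
  by rewrite powR0 ?powR_ge0// oppr_eq0 lt_eqF.
apply: ger_powR => //.
by rewrite lt_neqAle eq_sym dx0 dist_bdry_ge0 ltW.
Qed.
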